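(* The partitions of $AG(4,3)$ into four mutually disjoint maximal caps together with their common anchor point fall into exactly two equivalence classes under the action of the affine group $\mathit{Aff}(4,3)$. In each such partition the four caps split into two pairs that are either both 1-completable pairs or both 2-completable pairs; one equivalence class consists of the partitions with two 1-completable pairs, and the other consists of the partitions with two 2-completable pairs.
   Context: $AG(4,3)$ is $\mathbb{F}_3^4$; lines are sets $\{\vec{x},\vec{y},\vec{z}\}$ of three distinct points with $\vec{x}+\vec{y}+\vec{z}=\vec{0}$ mod 3. A cap is a set with no three collinear points; a maximal cap is a cap of largest size (20 points). Every maximal cap $S$ has a unique anchor point $\vec{a}\notin S$: $S$ is a union of 10 pairs of points each forming a line with $\vec{a}$. A partition (with anchor $\vec{a}$) is a collection $\{\{\vec{a}\},A,B,C,D\}$ of mutually disjoint maximal caps $A,B,C,D$ each with anchor $\vec{a}$, whose union with $\{\vec{a}\}$ is $AG(4,3)$. A pair $\{X,Y\}$ of disjoint maximal caps with a common anchor is a 1-completable pair (resp. 2-completable pair) if it is contained in exactly one (resp. exactly two) partitions. $\mathit{Aff}(4,3)=GL(4,3)\ltimes\mathbb{F}_3^4$ acts by $\vec{v}\mapsto A\vec{v}+\vec{b}$, mapping caps to caps and partitions to partitions. *)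

(* Defs.v *)
From mathcomp Require Import all_boot all_algebra all_fingroup.

Set Implicit Arguments.
Unset Strict Implicit.
Unset Printing Implicit Defensive.

Import GRing.Theory.
Local Open Scope ring_scope.

Notation AG43 := 'cV['F_3]_4.

Definition is_line (L : {set AG43}) : bool :=
  (#|L| == 3)%N && (\sum_(v in L) v == 0).

Definition is_cap (S : {set AG43}) : bool :=
  [forall L : {set AG43}, is_line L ==> ~~ (L \subset S)].

(* A cap of largest size, not merely one maximal under inclusion. *)
Definition is_maxcap (S : {set AG43}) : bool :=
  is_cap S && [forall T : {set AG43}, is_cap T ==> (#|T| <= #|S|)%N].

(* The conditions #|p| = 2 and is_line (a |: p) together force a \notin p. *)
Definition is_anchor (a : AG43) (S : {set AG43}) : bool :=
  (a \notin S) &&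
  [exists Q : {set {set AG43}},
    [&& (#|Q| == 10)%N,
        [forall p in Q, (#|p| == 2)%N && is_line (a |: p)] &
        cover Q == S]].

Definition is_cap_partition (a : AG43) (P : {set {set AG43}}) : bool :=
  [&& partition P [set: AG43],
      [set a] \in P,
      (#|P :\ [set a]| == 4)%N &
      [forall X in P :\ [set a], is_maxcap X && is_anchor a X]].

Definition cap_partitions : {set {set {set AG43}}} :=
  [set P | [exists a, is_cap_partition a P]].

Definition completable_pair (k : nat) (X Y : {set AG43}) : bool :=
  [&& is_maxcap X, is_maxcap Y, [disjoint X & Y],
      [exists a, is_anchor a X && is_anchor a Y] &
      #|[set P in cap_partitions | [set X; Y] \subset P]| == k].

(* The blocks X, Y, Z, W are automatically pairwise distinct and different
   from [set a], since P has exactly four blocks other than [set a]. *)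
Definition splits_into_completable_pairs (k : nat) (P : {set {set AG43}})
    : Prop :=
  exists (a : AG43) (X Y Z W : {set AG43}),
    [/\ is_cap_partition a P,
        P = [set [set a]; X; Y; Z; W],
        completable_pair k X Y &
        completable_pair k Z W].

(* Aff(4,3), realised as the group of permutations v |-> A v + b of AG(4,3). *)
Definition Aff43 : {set {perm AG43}} :=
  [set s : {perm AG43} |
    [exists A : 'M['F_3]_4, exists b : AG43,
      (A \in unitmx) && [forall v, s v == A *m v + b]]].

Lemma Aff43_group_set : group_set Aff43.
Proof.
apply/group_setP; split=> [|s t].
  rewrite inE; apply/existsP; exists 1%:M; apply/existsP; exists 0.
  by rewrite unitmx1; apply/forallP => v; rewrite perm1 mul1mx addr0.
rewrite !inE => /existsP[A /existsP[b /andP[uA /forallP sE]]].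
move=> /existsP[B /existsP[c /andP[uB /forallP tE]]].
apply/existsP; exists (B *m A); apply/existsP; exists (B *m b + c).
rewrite unitmx_mul uA uB; apply/forallP => v.
by rewrite permM (eqP (tE _)) (eqP (sE _)) mulmxDr mulmxA addrA.
Qed.

Canonical Aff43_group := Group Aff43_group_set.

(* 'P is the action of {perm AG43} on points; each ^* lifts it by direct image,
   first to sets of points and then to sets of sets of points. *)
Definition Aff43_class (P : {set {set AG43}}) : {set {set {set AG43}}} :=
  orbit ('P^*^*)%act Aff43 P.

Definition cap_partition_classes : {set {set {set {set AG43}}}} :=
  [set Aff43_class P | P in cap_partitions].

(* Main.v *)
(* Put the anchor at 0. A maximal cap with anchor 0 is then closed under
   v |-> -v, so it is the cone over a 10-cap of PG(3,3) (an ovoid, in fact an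
   elliptic quadric), and a partition is a partition of the 40 points of
   PG(3,3) into four ovoids.

   No cap of AG(4,3) has more than 20 points. Given a 21-cap, split it by the 40
   parallel classes of hyperplanes, each hyperplane meeting it in at most 9
   points; let s2 and s3 be the sums of squares and of cubes of the three parts
   of a class. Then s3 + 1764 >= 19 s2, with equality only if s2 = 3 mod 24.
   Counting pairs and triples of cap points that share a hyperplane shows that
   equality holds in the sum over the 40 classes, but also that s2 adds up to
   6300, which is not 40 * 3 mod 24.

   An ovoid is not contained in a hyperplane, so it can be moved to one through
   the standard basis; exactly 24 ovoids pass through the basis and the signed
   permutation matrices move each of them to a fixed ovoid E0. A search lists
   the 216 partitions containing E0, and symmetries of E0 move each of them to
   one of two partitions, which are told apart by the numbers of partitions
   containing the pairs {E0, Y} of their blocks: 1, 6, 6 and 2, 6, 6. *)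
Require Import Defs.
From HB Require Import structures.
From mathcomp Require Import all_boot all_algebra all_fingroup.
From mathcomp Require Import zify ring.

Set Implicit Arguments.
Unset Strict Implicit.
Unset Printing Implicit Defensive.

Import GRing.Theory.

(** * Points of AG(4,3) as quadruples over F_3 *)

(** An enumerated copy of F_3 on which the finite checks evaluate by [vm_compute]; [enc] and [dec]
    translate between quadruples of these and column vectors. *)
Inductive trit := T0 | T1 | T2.

Definition trit_eqb (a b : trit) : bool :=
  match a, b with T0, T0 | T1, T1 | T2, T2 => true | _, _ => false end.

Lemma trit_eqP : Equality.axiom trit_eqb.
Proof. by case; case; constructor. Qed.

HB.instance Definition _ := hasDecEq.Build trit trit_eqP.

Definition tadd (a b : trit) : trit :=
  match a, b with
  | T0, c => c | c, T0 => c
  | T1, T1 => T2 | T2, T2 => T1 | _, _ => T0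
  end.

Definition topp (a : trit) : trit :=
  match a with T0 => T0 | T1 => T2 | T2 => T1 end.

Definition tmul (a b : trit) : trit :=
  match a, b with
  | T0, _ | _, T0 => T0
  | T1, c => c | T2, c => topp c
  end.

Definition trits : seq trit := [:: T0; T1; T2].

Inductive pt := Pt of trit & trit & trit & trit.

Definition pt_eqb (x y : pt) : bool :=
  let: Pt a b c d := x in let: Pt a' b' c' d' := y in
  [&& trit_eqb a a', trit_eqb b b', trit_eqb c c' & trit_eqb d d'].

Lemma pt_eqP : Equality.axiom pt_eqb.
Proof.
move=> [a b c d] [a' b' c' d']; apply: (iffP and4P).
  by case=> /trit_eqP-> /trit_eqP-> /trit_eqP-> /trit_eqP->.
by case=> -> -> -> ->; split; apply/trit_eqP.
Qed.

HB.instance Definition _ := hasDecEq.Build pt pt_eqP.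

Definition pzero : pt := Pt T0 T0 T0 T0.

Definition padd (x y : pt) : pt :=
  let: Pt a b c d := x in let: Pt a' b' c' d' := y in
  Pt (tadd a a') (tadd b b') (tadd c c') (tadd d d').

Definition popp (x : pt) : pt :=
  let: Pt a b c d := x in Pt (topp a) (topp b) (topp c) (topp d).

Definition psub (x y : pt) : pt := padd x (popp y).

Definition pscale (t : trit) (x : pt) : pt :=
  let: Pt a b c d := x in Pt (tmul t a) (tmul t b) (tmul t c) (tmul t d).

Definition dot (x y : pt) : trit :=
  let: Pt a b c d := x in let: Pt a' b' c' d' := y in
  tadd (tadd (tmul a a') (tmul b b')) (tadd (tmul c c') (tmul d d')).

Definition pts : seq pt :=
  [seq f d | f <- [seq f c | f <- [seq Pt a b | a <- trits, b <- trits],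
                             c <- trits], d <- trits].

(** Of [x] and [-x], the one whose first nonzero coordinate is 1: the name of the point of PG(3,3)
    spanned by [x]. *)
Definition pnorm (x : pt) : pt :=
  let: Pt a b c d := x in
  let s := match a, b, c, d with
    | T0, T0, T0, t => t | T0, T0, t, _ => t | T0, t, _, _ => t | t, _, _, _ => t
    end in
  if s is T2 then popp x else x.

(* Representatives of the 40 points of PG(3,3); by duality they also stand for
   the 40 parallel classes of hyperplanes of AG(4,3). *)
Definition reps : seq pt := [seq x <- pts | (x != pzero) && (pnorm x == x)].

Arguments pts : simpl never.
Arguments reps : simpl never.

Lemma mem_pts (x : pt) : x \in pts.
Proof. by case: x => -[] [] [] []. Qed.

Lemma forall_pt (p : pred pt) : all p pts -> forall x, p x.
Proof. by move=> /allP h x; apply/h/mem_pts. Qed.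

Lemma forall_pt2 (p : rel pt) : all (fun x => all (p x) pts) pts ->
  forall x y, p x y.
Proof. by move=> /forall_pt h x; apply/forall_pt/h. Qed.

Lemma uniq_pts : uniq pts. Proof. by vm_compute. Qed.

Lemma uniq_reps : uniq reps. Proof. exact/filter_uniq/uniq_pts. Qed.

Lemma mem_reps (x : pt) : (x \in reps) = (x != pzero) && (pnorm x == x).
Proof. by rewrite mem_filter mem_pts andbT. Qed.

Lemma taddA : associative tadd. Proof. by do 3!case. Qed.
Lemma taddC : commutative tadd. Proof. by do 2!case. Qed.
Lemma tmulDr : right_distributive tmul tadd. Proof. by do 3!case. Qed.
Lemma tmulN (a b : trit) : tmul a (topp b) = topp (tmul a b).
Proof. by case: a; case: b. Qed.
Lemma toppD (a b : trit) : topp (tadd a b) = tadd (topp a) (topp b).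
Proof. by case: a; case: b. Qed.
Lemma taddACA : interchange tadd tadd.
Proof.
by move=> a b c d; rewrite -!taddA; congr tadd; rewrite taddA (taddC b) -taddA.
Qed.

Lemma dotD (u x y : pt) : dot u (padd x y) = tadd (dot u x) (dot u y).
Proof.
case: u x y => [a b c d] [a1 b1 c1 d1] [a2 b2 c2 d2] /=.
by rewrite !tmulDr (taddACA (tmul a a1)) (taddACA (tmul c c1)) taddACA.
Qed.

Lemma dotN (u x : pt) : dot u (popp x) = topp (dot u x).
Proof. by case: u x => [a b c d] [a1 b1 c1 d1] /=; rewrite !tmulN !toppD. Qed.

Lemma dot_eq (u x y : pt) : (dot u x == dot u y) = (dot u (psub y x) == T0).
Proof. by rewrite dotD dotN; case: (dot u x); case: (dot u y). Qed.

Lemma psub_eq0 (x y : pt) : (psub x y == pzero) = (x == y).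
Proof.
apply/eqP/eqP => [|->]; case: y => [a b c d]; last by case: a b c d => -[] [] [].
case: x => [a' b' c' d'] /= [].
have E : forall r s, tadd r (topp s) = T0 -> r = s by do 2!case.
by move=> /E-> /E-> /E-> /E->.
Qed.

(** Since -2 = 1 in F_3. Hence distinct [x], [y], [z] are collinear exactly when [y - x] and [z - x]
    are opposite. *)
Lemma padd_psub (x y z : pt) :
  padd (psub y x) (psub z x) = padd (padd x y) z.
Proof.
case: x y z => [a b c d] [a1 b1 c1 d1] [a2 b2 c2 d2] /=.
have E : forall r s t, tadd (tadd s (topp r)) (tadd t (topp r)) = tadd (tadd r s) t.
  by do 3!case.
by rewrite !E.
Qed.

Lemma psub_inj (x y z : pt) : (psub y x == psub z x) = (y == z).
Proof.
apply/eqP/eqP => [|->//].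
case: x y z => [a b c d] [a1 b1 c1 d1] [a2 b2 c2 d2] /=.
have E : forall r s t, tadd s (topp r) = tadd t (topp r) -> s = t by do 3!case.
by case=> /E-> /E-> /E-> /E->.
Qed.

(** * Caps of AG(4,3) have at most 20 points *)

Definition hyp_count (T : seq pt) (u : pt) (c : trit) : nat :=
  count (fun x => dot u x == c) T.

Lemma count_sum (U : seq pt) (p : pred pt) : count p U = \sum_(u <- U) p u.
Proof. by rewrite -sum1_count big_mkcond; apply: eq_bigr => x _; case: (p x). Qed.

Lemma hyp_countE (T : seq pt) (u : pt) (c : trit) :
  hyp_count T u c = \sum_(x <- T) (dot u x == c).
Proof. exact: count_sum. Qed.

Lemma sum_hyp_count (T : seq pt) (u : pt) :
  hyp_count T u T0 + hyp_count T u T1 + hyp_count T u T2 = size T.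
Proof. by elim: T => //= x T <-; case: (dot u x) => /=; lia. Qed.

Lemma sum_trits (F : trit -> nat) : \sum_(c <- trits) F c = F T0 + F T1 + F T2.
Proof. by rewrite /trits !big_cons big_nil addn0 addnA. Qed.

(** Both sides count the [(u, x, y)] such that [x] and [y] lie in the same hyperplane of the class
    of [u]. *)
Lemma sum_hyp_count2 (U T : seq pt) :
  \sum_(u <- U) \sum_(c <- trits) hyp_count T u c ^ 2 =
  \sum_(x <- T) \sum_(y <- T) count (fun u => dot u x == dot u y) U.
Proof.
under [RHS]eq_bigr => x _ do (under eq_bigr => y _ do rewrite count_sum).
under [RHS]eq_bigr => x _ do rewrite exchange_big.
rewrite [RHS]exchange_big; apply: eq_bigr => u _ /=.
under eq_bigr => c _ do rewrite hyp_countE -mulnn big_distrlr /=.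
rewrite exchange_big; apply: eq_bigr => x _ /=.
rewrite exchange_big; apply: eq_bigr => y _ /=.
by rewrite sum_trits; case: (dot u x); case: (dot u y).
Qed.

Lemma sum_hyp_count3 (U T : seq pt) :
  \sum_(u <- U) \sum_(c <- trits) hyp_count T u c ^ 3 =
  \sum_(x <- T) \sum_(y <- T) \sum_(z <- T)
     count (fun u => (dot u x == dot u y) && (dot u x == dot u z)) U.
Proof.
under [RHS]eq_bigr => x _ do (under eq_bigr => y _ do
  (under eq_bigr => z _ do rewrite count_sum)).
under [RHS]eq_bigr => x _ do (under eq_bigr => y _ do rewrite exchange_big).
under [RHS]eq_bigr => x _ do rewrite exchange_big.
rewrite [RHS]exchange_big; apply: eq_bigr => u _ /=.
under eq_bigr => c _ do rewrite hyp_countE expnS -mulnn big_distrlr big_distrlr /=.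
rewrite exchange_big; apply: eq_bigr => x _ /=.
under eq_bigr => c _ do (under eq_bigr => y _ do rewrite big_distrr /=).
rewrite exchange_big; apply: eq_bigr => y _ /=.
rewrite exchange_big; apply: eq_bigr => z _ /=.
by rewrite sum_trits; case: (dot u x); case: (dot u y); case: (dot u z).
Qed.

Lemma sum_one_exception (T : eqType) (s : seq T) (f : T -> nat) (x : T) (b : nat) :
    uniq s -> x \in s -> {in s, forall y, y != x -> f y = b} ->
  \sum_(y <- s) f y = f x + (size s).-1 * b.
Proof.
move=> us xs fb; rewrite (big_rem x) //=; congr addn.
transitivity (\sum_(y <- rem x s) b).
  rewrite big_seq [RHS]big_seq; apply: eq_bigr => y.
  by rewrite mem_rem_uniq // inE => /andP[yx ys]; apply: fb.
by rewrite big_const_seq count_predT iter_addn_0 size_rem // mulnC.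
Qed.

Lemma sum_two_exceptions (T : eqType) (s : seq T) (f : T -> nat) (x y : T) (c : nat) :
    uniq s -> x \in s -> y \in s -> x != y ->
    {in s, forall z, z != x -> z != y -> f z = c} ->
  \sum_(z <- s) f z = f x + f y + (size s).-2 * c.
Proof.
move=> us xs ys xy fc; rewrite (big_rem x) //= -addnA; congr addn.
rewrite -(size_rem xs); apply: sum_one_exception; first exact: rem_uniq.
  by rewrite mem_rem_uniq // inE eq_sym xy.
by move=> z; rewrite mem_rem_uniq // inE => /andP[zx zs]; apply: fc.
Qed.

Lemma sum_pairs (T : eqType) (s : seq T) (f : T -> T -> nat) (a b : nat) :
    uniq s -> {in s, forall x, f x x = a} ->
    {in s &, forall x y, x != y -> f x y = b} ->
  \sum_(x <- s) \sum_(y <- s) f x y = size s * (a + (size s).-1 * b).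
Proof.
move=> us fa fb; rewrite big_seq.
under eq_bigr => x xs.
  rewrite (@sum_one_exception _ s (f x) x b) ?fa //; last first.
    by move=> y ys yx; rewrite fb // eq_sym.
  over.
by rewrite -big_seq big_const_seq count_predT iter_addn_0 mulnC.
Qed.

(** For fixed [x], the choice [y = x] contributes [a] once and [b] for every other [z]; each other
    [y] contributes [b] twice, at [z = x] and [z = y], and [c] for every remaining [z]. *)
Lemma sum_triples (T : eqType) (s : seq T) (f : T -> T -> T -> nat) (a b c : nat) :
    uniq s -> {in s, forall x, f x x x = a} ->
    {in s &, forall x y, x != y -> [/\ f x x y = b, f x y x = b & f x y y = b]} ->
    {in s & &, forall x y z, x != y -> y != z -> x != z -> f x y z = c} ->
  \sum_(x <- s) \sum_(y <- s) \sum_(z <- s) f x y z =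
  size s * (a + (size s).-1 * b + (size s).-1 * (b + b + (size s).-2 * c)).
Proof.
move=> us fa fb fc; rewrite big_seq.
under eq_bigr => x xs.
  rewrite (@sum_one_exception _ s _ x (b + b + (size s).-2 * c)) //; last first.
    move=> y ys; rewrite eq_sym => xy; have [_ fxyx fxyy] := fb x y xs ys xy.
    rewrite (@sum_two_exceptions _ s _ x y c) ?fxyx ?fxyy // => z zs zx zy.
    by rewrite fc // eq_sym.
  rewrite (@sum_one_exception _ s _ x b) //; last first.
    by move=> z zs; rewrite eq_sym => xz; have [-> _ _] := fb x z xs zs xz.
  rewrite fa //; over.
by rewrite -big_seq big_const_seq count_predT iter_addn_0 mulnC.
Qed.

Definition pt_cap (T : seq pt) : Prop :=
  {in T & &, forall x y z, x != y -> y != z -> x != z ->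
     padd (padd x y) z != pzero}.

Lemma pt_cap_sub (T T' : seq pt) : {subset T' <= T} -> pt_cap T -> pt_cap T'.
Proof. by move=> sT cT x y z /sT xT /sT yT /sT; apply: cT. Qed.

Lemma pt_cap_take (n : nat) (T : seq pt) : n <= size T -> uniq T -> pt_cap T ->
  [/\ size (take n T) = n, uniq (take n T) & pt_cap (take n T)].
Proof.
move=> nT uT cT; split; [by rewrite size_takel | exact: take_uniq |].
by apply: pt_cap_sub cT => x /mem_take.
Qed.

Lemma pt_cap_filter (p : pred pt) (T : seq pt) : pt_cap T -> pt_cap (filter p T).
Proof. by apply: pt_cap_sub => x; rewrite mem_filter => /andP[]. Qed.

Definition forms2 (u1 : pt) : seq pt := [seq u <- reps | u != u1].

(** The four excluded forms are the points of the dual projective line through [u1] and [u2]; what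
    is left is independent of both. *)
Definition forms3 (u1 u2 : pt) : seq pt :=
  [seq u <- reps |
    u \notin [:: u1; u2; pnorm (padd u1 u2); pnorm (psub u1 u2)]].

Definition kernel (us : seq pt) : seq pt :=
  foldr (fun u s => [seq x <- s | dot u x == T0]) pts us.

Arguments forms2 : simpl never.
Arguments forms3 : simpl never.
Arguments kernel : simpl never.

Lemma mem_kernel (us : seq pt) (x : pt) :
  (x \in kernel us) = all (fun u => dot u x == T0) us.
Proof.
elim: us => [|u us IH]; first by rewrite mem_pts.
by rewrite /kernel /= mem_filter IH.
Qed.

(** Three independent forms on F_3^4 have common zeros [{0, d, -d}]. *)
Lemma kernel3_line (u1 u2 u3 d d' : pt) :
    u1 \in reps -> u2 \in forms2 u1 -> u3 \in forms3 u1 u2 ->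
    let K := [seq x <- kernel [:: u3; u2; u1] | x != pzero] in
    d \in K -> d' \in K ->
  (d == d') || (padd d d' == pzero).
Proof.
move=> r1 r2 r3 K dK d'K.
have : all (fun u1 => all (fun u2 => all (fun u3 =>
    let K := [seq x <- kernel [:: u3; u2; u1] | x != pzero] in
    all (fun d => all (fun d' => (d == d') || (padd d d' == pzero)) K) K)
  (forms3 u1 u2)) (forms2 u1)) reps by vm_compute.
by move=> /allP/(_ _ r1)/allP/(_ _ r2)/allP/(_ _ r3)/allP/(_ _ dK)/allP/(_ _ d'K).
Qed.

(** The 4 forms in the span of [u1] and [u2] are left out, and they all vanish at [d]: 36 = 40 - 4
    and 9 = 13 - 4. *)
Lemma kernel2_count (u1 u2 : pt) :
    u1 \in reps -> u2 \in forms2 u1 ->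
  size (forms3 u1 u2) = 36 /\
  {in kernel [:: u2; u1], forall d, d != pzero ->
     count (fun u => dot u d == T0) (forms3 u1 u2) = 9}.
Proof.
move=> r1 r2; have : all (fun u1 => all (fun u2 =>
    let U := forms3 u1 u2 in
    (size U == 36) &&
    all (fun d => (d != pzero) ==> (count (fun u => dot u d == T0) U == 9))
      (kernel [:: u2; u1])) (forms2 u1)) reps by vm_compute.
move=> /allP/(_ _ r1)/allP/(_ _ r2)/andP[/eqP sU /allP h]; split=> // d /h.
by move=> /implyP imp /imp/eqP.
Qed.

Lemma kernel1_count (u1 : pt) :
    u1 \in reps ->
  size (forms2 u1) = 39 /\
  {in kernel [:: u1], forall d, d != pzero ->
     count (fun u => dot u d == T0) (forms2 u1) = 12}.
Proof.
move=> r1; have : all (fun u1 =>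
    let U := forms2 u1 in
    (size U == 39) &&
    all (fun d => (d != pzero) ==> (count (fun u => dot u d == T0) U == 12))
      (kernel [:: u1])) reps by vm_compute.
move=> /allP/(_ _ r1)/andP[/eqP sU /allP h]; split=> // d /h.
by move=> /implyP imp /imp/eqP.
Qed.

Lemma size_reps : size reps = 40. Proof. by vm_compute. Qed.

Lemma kernel0_count (d : pt) :
  d != pzero -> count (fun u => dot u d == T0) reps = 13.
Proof.
move=> d0; apply/eqP; move: d d0.
have : forall d, (d != pzero) ==> (count (fun u => dot u d == T0) reps == 13).
  by apply: forall_pt; vm_compute.
by move=> h d; apply/implyP/h.
Qed.

(** The vectors span two distinct points of PG(3,3), and the line through these lies in 4 planes. *)
Lemma kernel0_count2 (d d' : pt) :
    d != pzero -> d' != pzero -> d != d' -> padd d d' != pzero ->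
  count (fun u => (dot u d == T0) && (dot u d' == T0)) reps = 4.
Proof.
move=> d0 d'0 dd' dd'0; apply/eqP; move: d d' d0 d'0 dd' dd'0.
have : forall d d', [&& d != pzero, d' != pzero, d != d' & padd d d' != pzero] ==>
    (count (fun u => (dot u d == T0) && (dot u d' == T0)) reps == 4).
  by apply: forall_pt2; vm_compute.
by move=> h d d' d0 d'0 dd' dd'0; apply: (implyP (h d d')); apply/and4P.
Qed.

(** For three points, [y - x] and [z - x] would be nonzero vectors of some [{0, d, -d}]: if equal,
    then [y = z]; if opposite, the cap contains a line. *)
Lemma cap_line (u1 u2 u3 : pt) (c1 c2 c3 : trit) (T : seq pt) :
    u1 \in reps -> u2 \in forms2 u1 -> u3 \in forms3 u1 u2 ->
    uniq T -> pt_cap T ->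
    {in T, forall x, [/\ dot u1 x = c1, dot u2 x = c2 & dot u3 x = c3]} ->
  size T <= 2.
Proof.
move=> r1 r2 r3 uT cT hT; rewrite leqNgt; apply/negP => lt2.
case: T uT cT hT lt2 => [|x [|y [|z T]]] //=.
rewrite !inE !negb_or => /and3P[/and3P[xy xz _] /andP[yz _] _] cT hT _.
have xT : x \in [:: x, y, z & T] by rewrite inE eqxx.
have yT : y \in [:: x, y, z & T] by rewrite !inE eqxx orbT.
have zT : z \in [:: x, y, z & T] by rewrite !inE eqxx !orbT.
have inK w : w \in [:: x, y, z & T] -> x != w ->
    psub w x \in [seq x <- kernel [:: u3; u2; u1] | x != pzero].
  move=> wT xw; rewrite mem_filter psub_eq0 eq_sym xw mem_kernel /= -!dot_eq.
  by have [-> -> ->] := hT _ wT; have [-> -> ->] := hT _ xT; rewrite !eqxx.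
have := kernel3_line r1 r2 r3 (inK _ yT xy) (inK _ zT xz).
by rewrite padd_psub psub_inj (negPf yz) (negPf (cT _ _ _ xT yT zT xy yz xz)).
Qed.

Lemma sum_squares2 (a b c : nat) :
  a <= 2 -> b <= 2 -> c <= 2 -> a + b + c = 5 -> a ^ 2 + b ^ 2 + c ^ 2 <= 9.
Proof. by case: a => [|[|[|?]]] //; case: b => [|[|[|?]]] //; case: c => [|[|[|?]]]. Qed.

Lemma leq_sum_const (T : eqType) (s : seq T) (f : T -> nat) (k : nat) :
  {in s, forall x, f x <= k} -> \sum_(x <- s) f x <= size s * k.
Proof.
move=> h; apply: (@leq_trans (\sum_(x <- s) k)).
  by rewrite big_seq [leqRHS]big_seq; apply: leq_sum => x /h.
by rewrite big_const_seq count_predT iter_addn_0 mulnC.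
Qed.

(** Double counting for five points: each of the 36 classes splits them into parts of at most 2
    points, so the squares add up to at most 36 * 9 = 324, but the pairs give 5 * (36 + 4 * 9) =
    360. *)
Lemma cap_plane (u1 u2 : pt) (c1 c2 : trit) (T : seq pt) :
    u1 \in reps -> u2 \in forms2 u1 -> uniq T -> pt_cap T ->
    {in T, forall x, dot u1 x = c1 /\ dot u2 x = c2} ->
  size T <= 4.
Proof.
move=> r1 r2 uT0 cT0 hT0; rewrite leqNgt; apply/negP => lt4.
have [sT uT cT] := pt_cap_take lt4 uT0 cT0.
have {hT0} : {in take 5 T, forall x, dot u1 x = c1 /\ dot u2 x = c2}.
  by move=> x /mem_take/hT0.
move: (take 5 T) sT uT cT => {uT0 cT0 lt4} {}T sT uT cT hT.
have [sU cU] := kernel2_count r1 r2.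
have := sum_hyp_count2 (forms3 u1 u2) T.
rewrite (@sum_pairs _ T _ 36 9) // ?sT; last 2 first.
- by move=> x _; rewrite -sU -count_predT; apply: eq_count => u; rewrite eqxx.
- move=> x y xT yT xy.
  rewrite -(cU (psub y x)) ?psub_eq0 1?eq_sym //; last first.
    rewrite mem_kernel /= -!dot_eq.
    by have [-> ->] := hT _ xT; have [-> ->] := hT _ yT; rewrite !eqxx.
  by apply: eq_count => u; rewrite dot_eq.
have : \sum_(u <- forms3 u1 u2) \sum_(c <- trits) hyp_count T u c ^ 2 <= 36 * 9.
  rewrite -sU; apply: leq_sum_const => u uU; rewrite sum_trits.
  have le2 c : hyp_count T u c <= 2.
    rewrite /hyp_count -size_filter.
    apply: (cap_line (c1 := c1) (c2 := c2) (c3 := c) r1 r2 uU).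
    - exact: filter_uniq.
    - exact: pt_cap_filter.
    by move=> x; rewrite mem_filter => /andP[/eqP-> /hT[-> ->]].
  by apply: sum_squares2; rewrite ?sum_hyp_count.
by move=> + E; rewrite E.
Qed.

Lemma sum_squares4 (a b c : nat) :
  a <= 4 -> b <= 4 -> c <= 4 -> a + b + c = 10 -> a ^ 2 + b ^ 2 + c ^ 2 <= 36.
Proof.
by case: a => [|[|[|[|[|?]]]]] //; case: b => [|[|[|[|[|?]]]]] //;
   case: c => [|[|[|[|[|?]]]]].
Qed.

(** The same count one dimension up: for ten points, 39 classes with parts of at most 4 points allow
    at most 39 * 36 = 1404, but the pairs give 10 * (39 + 9 * 12) = 1470. *)
Lemma cap_hyperplane (u1 : pt) (c1 : trit) (T : seq pt) :
    u1 \in reps -> uniq T -> pt_cap T -> {in T, forall x, dot u1 x = c1} ->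
  size T <= 9.
Proof.
move=> r1 uT0 cT0 hT0; rewrite leqNgt; apply/negP => lt9.
have [sT uT cT] := pt_cap_take lt9 uT0 cT0.
have {hT0} : {in take 10 T, forall x, dot u1 x = c1} by move=> x /mem_take/hT0.
move: (take 10 T) sT uT cT => {uT0 cT0 lt9} {}T sT uT cT hT.
have [sU cU] := kernel1_count r1.
have := sum_hyp_count2 (forms2 u1) T.
rewrite (@sum_pairs _ T _ 39 12) // ?sT; last 2 first.
- by move=> x _; rewrite -sU -count_predT; apply: eq_count => u; rewrite eqxx.
- move=> x y xT yT xy.
  rewrite -(cU (psub y x)) ?psub_eq0 1?eq_sym //; last first.
    by rewrite mem_kernel /= -dot_eq !hT // eqxx.
  by apply: eq_count => u; rewrite dot_eq.
have : \sum_(u <- forms2 u1) \sum_(c <- trits) hyp_count T u c ^ 2 <= 39 * 36.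
  rewrite -sU; apply: leq_sum_const => u uU; rewrite sum_trits.
  have le4 c : hyp_count T u c <= 4.
    rewrite /hyp_count -size_filter.
    apply: (cap_plane (c1 := c1) (c2 := c) r1 uU).
    - exact: filter_uniq.
    - exact: pt_cap_filter.
    by move=> x; rewrite mem_filter => /andP[/eqP-> /hT->].
  by apply: sum_squares4; rewrite ?sum_hyp_count.
by move=> + E; rewrite E.
Qed.

(* Equality in the first inequality holds only for the splittings (7, 7, 7) and
   (9, 9, 3), whose sums of squares are 147 and 171. *)
Lemma sum_cubes9 (a b c : nat) :
    a <= 9 -> b <= 9 -> c <= 9 -> a + b + c = 21 ->
  let s2 := a ^ 2 + b ^ 2 + c ^ 2 in let s3 := a ^ 3 + b ^ 3 + c ^ 3 in
  [&& 19 * s2 <= s3 + 1764, 147 <= s2 &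
      (19 * s2 == s3 + 1764) ==> (24 %| s2 - 147)].
Proof.
rewrite -!(ltnS _ 9) => la lb lc /eqP E /=.
have : all (fun a => all (fun b => all (fun c => (a + b + c == 21) ==>
  let s2 := a ^ 2 + b ^ 2 + c ^ 2 in let s3 := a ^ 3 + b ^ 3 + c ^ 3 in
  [&& 19 * s2 <= s3 + 1764, 147 <= s2 &
      (19 * s2 == s3 + 1764) ==> (24 %| s2 - 147)])
  (iota 0 10)) (iota 0 10)) (iota 0 10) by vm_compute.
have I n : n < 10 -> n \in iota 0 10 by rewrite mem_iota.
by move=> /allP/(_ _ (I _ la))/allP/(_ _ (I _ lb))/allP/(_ _ (I _ lc))/implyP/(_ E).
Qed.

Theorem cap_bound (T : seq pt) : uniq T -> pt_cap T -> size T <= 20.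
Proof.
move=> uT0 cT0; rewrite leqNgt; apply/negP => lt20.
have [sT uT cT] := pt_cap_take lt20 uT0 cT0.
move: (take 21 T) sT uT cT => {uT0 cT0 lt20} {}T sT uT cT.
(* This is 21 * (40 + 20 * 13): two distinct points share a hyperplane in 13 of the 40 classes. *)
have E2 : \sum_(u <- reps) \sum_(c <- trits) hyp_count T u c ^ 2 = 63 * 100.
  rewrite sum_hyp_count2 (@sum_pairs _ T _ 40 13) ?sT // => [x _|x y _ _ xy].
    by rewrite -size_reps -count_predT; apply: eq_count => u; rewrite eqxx.
  rewrite -(@kernel0_count (psub y x)) ?psub_eq0 1?eq_sym //.
  by apply: eq_count => u; rewrite dot_eq.
(* This is 21 * (40 + 20 * 13 + 20 * (13 + 13 + 19 * 4)): three noncollinear points share a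
   hyperplane in 4 classes. *)
have E3 : \sum_(u <- reps) \sum_(c <- trits) hyp_count T u c ^ 3 = 4914 * 10.
  rewrite sum_hyp_count3 (@sum_triples _ T _ 40 13 4) ?sT //.
  - by move=> x _; rewrite -size_reps -count_predT; apply: eq_count => u; rewrite eqxx.
  - move=> x y _ _ xy; rewrite -(@kernel0_count (psub y x)) ?psub_eq0 1?eq_sym //.
    by split; apply: eq_count => u; rewrite -dot_eq ?eqxx ?andbT ?andbb.
  move=> x y z xT yT zT xy yz xz.
  rewrite -(@kernel0_count2 (psub y x) (psub z x)).
  - by apply: eq_count => u; rewrite -!dot_eq.
  - by rewrite psub_eq0 eq_sym.
  - by rewrite psub_eq0 eq_sym.
  - by rewrite psub_inj.
  by rewrite padd_psub cT.
pose s2 u := \sum_(c <- trits) hyp_count T u c ^ 2.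
pose s3 u := \sum_(c <- trits) hyp_count T u c ^ 3.
have S u : u \in reps -> [&& 19 * s2 u <= s3 u + 1764, 147 <= s2 u &
      (19 * s2 u == s3 u + 1764) ==> (24 %| s2 u - 147)].
  move=> ur; rewrite /s2 /s3 !sum_trits.
  have le9 c : hyp_count T u c <= 9.
    rewrite /hyp_count -size_filter.
    apply: (cap_hyperplane (c1 := c) ur); first exact: filter_uniq.
      exact: pt_cap_filter.
    by move=> x; rewrite mem_filter => /andP[/eqP->].
  by apply: sum_cubes9; rewrite ?sum_hyp_count.
(* The slack in the inequality; over all classes it adds up to 49140 + 40 * 1764 - 19 * 6300 = 0. *)
pose t u := s3 u + 1764 - 19 * s2 u.
have : \sum_(u <- reps) (19 * s2 u + t u) = \sum_(u <- reps) (s3 u + 1764).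
  rewrite big_seq [RHS]big_seq; apply: eq_bigr => u /S/and3P[le _ _].
  by rewrite subnKC.
have -> : \sum_(u <- reps) (19 * s2 u + t u) = 19 * (63 * 100) + \sum_(u <- reps) t u.
  by rewrite big_split /= -E2 big_distrr.
rewrite big_split /= E3 big_const_seq count_predT size_reps.
rewrite iter_addn_0 => E.
have /eqP : \sum_(u <- reps) t u = 0 by lia.
rewrite sum_nat_seq_eq0 => /allP t0.
have : 24 %| \sum_(u <- reps) (s2 u - 147).
  rewrite big_seq; apply: dvdn_sum => u ur.
  have /and3P[le _ /implyP] := S _ ur; apply.
  by rewrite eqn_leq le /= -subn_eq0; have /implyP/(_ isT) := t0 _ ur.
have : \sum_(u <- reps) (s2 u - 147 + 147) = \sum_(u <- reps) s2 u.
  rewrite big_seq [RHS]big_seq; apply: eq_bigr => u /S/and3P[_ le _].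
  by rewrite subnK.
rewrite E2 big_split /= big_const_seq count_predT size_reps.
(* The sum is 6300 - 40 * 147 = 420, which 24 does not divide. *)
by rewrite iter_addn_0 => E4; have -> : \sum_(u <- reps) (s2 u - 147) = 420 by lia.
Qed.

(** * Ovoids of PG(3,3): search and tables *)

(** The line of PG(3,3) through [x] and [y] has two further points, spanned by [x + y] and
    [x - y]. *)
Definition proj_cap (l : seq pt) : bool :=
  all (fun x => all (fun y => (x == y) ||
    ((pnorm (padd x y) \notin l) && (pnorm (psub x y) \notin l))) l) l.

Definition secants (x : pt) (ch : seq pt) : seq pt :=
  flatten [seq [:: pnorm (padd x y); pnorm (psub x y)] | y <- ch].

(** Backtracking: the first candidate is either taken or skipped. [k] is the number of points still
    to choose, and [fuel] makes the recursion structural, at one unit per candidate. *)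
Fixpoint cap_search (fuel k : nat) (ch cands : seq pt) : seq (seq pt) :=
  if k is k'.+1 then
    if fuel is f.+1 then
      if cands is x :: r then
        if size cands < k then [::] else
        cap_search f k' (x :: ch) [seq z <- r | z \notin secants x ch] ++
        cap_search f k ch r
      else [::]
    else [::]
  else [:: ch].

(** The order of [reps] gives each set of projective points one representation, so that sets compare
    by equality of lists. *)
Definition canon (l : seq pt) : seq pt := [seq x <- reps | x \in l].

Definition is_ovoid (b : seq pt) : bool :=
  [&& b == canon b, size b == 10 & proj_cap b].

Definition rest (bs : seq (seq pt)) : seq pt :=
  [seq x <- reps | ~~ has (fun b => x \in b) bs].

(** The search starts from the first point of [R]: a partition has exactly one block there, so
    following that block meets each partition once. *)
Definition ovoids (R : seq pt) : seq (seq pt) :=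
  if R is q :: R' then [seq canon l | l <- cap_search (size R') 9 [:: q] R']
  else [::].

Definition good_parts (bs : seq (seq pt)) : bool :=
  [&& size bs == 4, all is_ovoid bs & all (fun r => has (fun b => r \in b) bs) reps].

(** The new blocks come first: a symmetry of [E0] always passes the test at [x = E0], so
    [maps_parts] fails sooner this way. *)
Definition complete (x y c : seq pt) : seq (seq pt) := 
  [:: c; rest [:: x; y; c]; y; x].

(** The test by [good_parts] makes the entries sound by construction; what remains to prove is that
    the search misses none. *)
Definition completions (x y : seq pt) : seq (seq pt) :=
  let R := rest [:: x; y] in
  [seq c <- ovoids R | good_parts (complete x y c) && (head pzero R \in c)].

(** The columns of a matrix, that is, the images of the standard basis. *)
Definition mat : Type := pt * pt * pt * pt.

Definition mapply (m : mat) (x : pt) : pt :=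
  let: (c1, c2, c3, c4) := m in let: Pt a b c d := x in
  padd (padd (pscale a c1) (pscale b c2)) (padd (pscale c c3) (pscale d c4)).

Definition mmul (m m' : mat) : mat :=
  let: (c1, c2, c3, c4) := m' in
  (mapply m c1, mapply m c2, mapply m c3, mapply m c4).

Definition mat_inj (m : mat) : bool := all (fun x => mapply m x != pzero) reps.

(* Unlike [all] and [has], these stop early under call-by-value evaluation. *)
Fixpoint lazy_all (T : Type) (p : pred T) (s : seq T) : bool :=
  if s is x :: s' then if p x then lazy_all p s' else false else true.

Fixpoint lazy_has (T : Type) (p : pred T) (s : seq T) : bool :=
  if s is x :: s' then if p x then true else lazy_has p s' else false.

Lemma lazy_allE (T : Type) (p : pred T) (s : seq T) : lazy_all p s = all p s.
Proof. by elim: s => //= x s ->. Qed.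

Lemma lazy_hasE (T : Type) (p : pred T) (s : seq T) : lazy_has p s = has p s.
Proof. by elim: s => //= x s ->. Qed.

Definition maps_into (m : mat) (b c : seq pt) : bool :=
  lazy_all (fun x => pnorm (mapply m x) \in c) b.

Definition maps_parts (m : mat) (bs bs' : seq (seq pt)) : bool :=
  if lazy_all (fun b => lazy_has (maps_into m b) bs') bs then mat_inj m
  else false.

Definition basis : seq pt :=
  [:: Pt T1 T0 T0 T0; Pt T0 T1 T0 T0; Pt T0 T0 T1 T0; Pt T0 T0 T0 T1].

(** The first column carries no sign, as [m] and [-m] act alike on PG(3,3). *)
Definition signed_monomials : seq mat :=
  let sb := basis ++ map popp basis in
  [seq m <- [seq (f, x) | f <- [seq (f, x) | f <- [seq (x, y) | x <- basis, y <- sb],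
     x <- sb], x <- sb] | mat_inj m].

(** [cap_search] drops secants only through newly taken points, so the points on secants of the
    basis are dropped beforehand. *)
Definition basis_ovoids : seq (seq pt) :=
  [seq canon l | l <- cap_search 40 6 basis
    [seq z <- reps | (z \notin basis) && proj_cap (z :: basis)]].

(* Coefficients are listed in the order of the monomials
   aa, ab, ac, ad, bb, bc, bd, cc, cd, dd. *)
Definition quadric (q : seq trit) : seq pt :=
  let ev x := let: Pt a b c d := x in
    foldr tadd T0 [seq tmul p.1 (tmul p.2.1 p.2.2) | p <- zip q
      [:: (a, a); (a, b); (a, c); (a, d); (b, b); (b, c); (b, d); (c, c);
          (c, d); (d, d)]] in
  [seq x <- reps | ev x == T0].

(** The quadric ab + ac + ad + bc + bd - cd = 0; having no square terms, it passes through the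
    standard basis. *)
Definition E0 : seq pt := quadric [:: T0; T1; T1; T1; T0; T1; T1; T0; T2; T0].

(* Found by computer search, like [part2]. *)
Definition part1 : seq (seq pt) :=
  [:: E0;
      quadric [:: T1; T2; T1; T2; T2; T1; T2; T1; T0; T2];
      quadric [:: T1; T1; T0; T1; T2; T0; T1; T1; T1; T2];
      quadric [:: T1; T0; T2; T0; T2; T2; T0; T1; T2; T2]].

Definition part2 : seq (seq pt) :=
  [:: E0;
      quadric [:: T1; T0; T2; T0; T2; T0; T0; T2; T0; T1];
      quadric [:: T1; T0; T0; T0; T1; T0; T1; T2; T0; T2];
      quadric [:: T1; T0; T1; T2; T1; T2; T1; T2; T0; T2]].

Arguments canon : simpl never.
Arguments rest : simpl never.
Arguments E0 : simpl never.
Arguments part1 : simpl never.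
Arguments part2 : simpl never.

Definition mpowers (m : mat) (n : nat) : seq mat := traject (mmul m) m n.

(* Products g^i h^j g^k of two symmetries of [E0], of orders 10 and 6 in
   PGL(4,3); they already act transitively on the two kinds of partitions
   containing [E0]. *)
Definition E0_symmetries : seq mat :=
  let g := (Pt T0 T0 T0 T1, Pt T2 T2 T2 T0, Pt T2 T0 T0 T0, Pt T0 T2 T0 T0) in
  let h := (Pt T1 T2 T1 T2, Pt T0 T0 T0 T2, Pt T0 T0 T1 T0, Pt T2 T0 T0 T0) in
  [seq mmul f x | f <- [seq mmul x y | x <- mpowers g 10, y <- mpowers h 6],
                  x <- mpowers g 10].

Lemma basis_ovoids_equiv :
  all (fun o => is_ovoid o ==>
         lazy_has (fun m => maps_parts m [:: E0] [:: o]) signed_monomials)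
    basis_ovoids.
Proof. by vm_compute. Qed.

(** [y] stands for the block through the first point outside [E0], and [c] for the block through the
    first point outside both, so every partition containing [E0] is tested. *)
Lemma E0_partitions_equiv :
  all (fun y => all (fun c =>
      let bs := complete E0 y c in
      lazy_has (fun m => if maps_parts m bs part1 then true
                         else maps_parts m bs part2) E0_symmetries)
    (completions E0 y)) (ovoids (rest [:: E0])).
Proof. by vm_compute. Qed.

Lemma head_rest_E0 : head pzero (rest [:: E0]) \in rest [:: E0].
Proof. by vm_compute. Qed.

Definition block (bs : seq (seq pt)) (i : nat) : seq pt := nth [::] bs i.

Definition has_completions (k : nat) (bs : seq (seq pt)) (i j : nat) : bool :=
  let L := completions (block bs i) (block bs j) in (size L == k) && uniq L.

Lemma part1_good : good_parts part1. Proof. by vm_compute. Qed.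

Lemma part2_good : good_parts part2. Proof. by vm_compute. Qed.

(** The pairs 01 and 23 give the splitting; 02 and 03 complete the counts at block 0, which exclude
    a splitting into 2-completable pairs. *)
Lemma part1_completions :
  [&& has_completions 1 part1 0 1, has_completions 1 part1 2 3,
      has_completions 6 part1 0 2 & has_completions 6 part1 0 3].
Proof. by vm_compute. Qed.

Lemma part2_completions :
  [&& has_completions 2 part2 0 1, has_completions 2 part2 2 3,
      has_completions 6 part2 0 2 & has_completions 6 part2 0 3].
Proof. by vm_compute. Qed.

(** * Completeness of the search *)

Lemma proj_capP (l : seq pt) (x y : pt) :
    proj_cap l -> x \in l -> y \in l -> x != y ->
  (pnorm (padd x y) \notin l) /\ (pnorm (psub x y) \notin l).
Proof.
move=> /allP cl xl yl xy.
by have /allP/(_ _ yl) := cl _ xl; rewrite (negPf xy) => /andP.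
Qed.

Lemma proj_cap_sub (l l' : seq pt) :
  {subset l' <= l} -> proj_cap l -> proj_cap l'.
Proof.
move=> sl cl; apply/allP => x xl; apply/allP => y yl; case: eqP => //= /eqP xy.
have [h1 h2] := proj_capP cl (sl _ xl) (sl _ yl) xy.
by rewrite (contra (sl _) h1) (contra (sl _) h2).
Qed.

(** The invariant is that [b] lies between [ch] and [ch ++ cands]. If the first candidate is in [b],
    the points dropped with it lie on secants of [b], hence outside [b]; otherwise the branch that
    skips it is followed. *)
Lemma cap_search_complete (fuel k : nat) (ch cands b : seq pt) :
    uniq b -> proj_cap b -> uniq (ch ++ cands) ->
    {subset ch <= b} -> {subset b <= ch ++ cands} ->
    size b = size ch + k -> size cands <= fuel ->
  exists2 l, l \in cap_search fuel k ch cands & l =i b.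
Proof.
move=> ub cb; elim: fuel k ch cands => [|f IH] [|k] ch cands ucc chb bcc sb sf.
- exists ch; first by rewrite inE.
  have uch : uniq ch by move: ucc; rewrite cat_uniq => /and3P[].
  by case: (uniq_min_size uch chb); rewrite ?sb ?addn0.
- have c0 : cands = [::] by case: (cands) sf.
  have := uniq_leq_size ub bcc.
  by rewrite sb size_cat c0 /= leq_add2l.
- exists ch; first by rewrite inE.
  have uch : uniq ch by move: ucc; rewrite cat_uniq => /and3P[].
  by case: (uniq_min_size uch chb); rewrite ?sb ?addn0.
(* The points of [b] outside [ch] are all candidates, so this branch is not pruned. *)
have lek : k.+1 <= size cands.
  by have := uniq_leq_size ub bcc; rewrite sb size_cat leq_add2l.
case: cands ucc bcc sf lek => // x r ucc bcc sf lek.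
rewrite [cap_search _ _ _ _]/= ltnNge lek /=.
have uxcc : uniq (x :: ch ++ r) by rewrite -(perm_uniq (permEl (perm_catCA ch [:: x] r))).
have memc z : z \in ch ++ x :: r = (z \in x :: ch ++ r).
  exact: (perm_mem (permEl (perm_catCA ch [:: x] r))).
have [xb|xb] := boolP (x \in b); last first.
  have [||l lin lb] := IH k.+1 ch r _ chb _ sb sf.
  - by case/andP: uxcc.
  - move=> z zb; have := bcc z zb; rewrite memc inE => /orP[/eqP zx|//].
    by rewrite -zx zb in xb.
  by exists l => //; rewrite mem_cat lin orbT.
have xch : x \notin ch.
  by move: uxcc; rewrite /= mem_cat negb_or => /andP[/andP[]].
have [|||||l lin lb] :=
  IH k (x :: ch) [seq z <- r | z \notin secants x ch].
- move: uxcc; rewrite /= !mem_cat !negb_or !cat_uniq.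
  move=> /andP[/andP[-> xr] /and3P[-> hr ur]].
  rewrite filter_uniq // andbT mem_filter (negPf xr) andbF /=.
  apply: contra hr => /hasP[z]; rewrite mem_filter => /andP[_ zr] zch.
  by apply/hasP; exists z.
- by move=> z; rewrite inE => /orP[/eqP->|/chb].
- move=> z zb; have := bcc z zb; rewrite memc !inE !mem_cat mem_filter.
  case/or3P=> [->//|->|zr]; rewrite ?orbT // zr andbT.
  apply/orP; right; apply/orP; right.
  apply/flattenP => -[s /mapP[y ych ->]].
  have xy : x != y by apply: contraNneq xch => ->.
  have [h1 h2] := proj_capP cb xb (chb _ ych) xy.
  by rewrite !inE => /orP[] /eqP zE; [move: h1 | move: h2]; rewrite -zE zb.
- by rewrite sb /= addSnnS.
- by apply: (@leq_trans (size r)); rewrite // size_filter; apply: count_size.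
by exists l => //; rewrite mem_cat lin.
Qed.

Lemma canon_eq (l b : seq pt) : l =i b -> b == canon b -> canon l = b.
Proof. by move=> lb /eqP bc; rewrite [RHS]bc; apply: eq_filter => x; rewrite lb. Qed.

Lemma is_ovoidP (b : seq pt) :
  is_ovoid b -> [/\ b == canon b, size b = 10, proj_cap b, uniq b & {subset b <= reps}].
Proof.
move=> /and3P[bc /eqP sb cb]; split=> //.
  by rewrite (eqP bc); apply/filter_uniq/uniq_reps.
by move=> x; rewrite {1}(eqP bc) mem_filter => /andP[].
Qed.

Lemma ovoids_complete (R b : seq pt) :
    is_ovoid b -> uniq R -> {subset b <= R} -> head pzero R \in b ->
  b \in ovoids R.
Proof.
move=> /is_ovoidP[bc sb cb ub _]; case: R => [|q R] uR bR qb.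
  by case: b sb bR {bc cb ub qb} => // x b _ /(_ x); rewrite mem_head => /(_ isT).
have [|l lin lb] := cap_search_complete (fuel := size R) (k := 9) (ch := [:: q])
  (cands := R) ub cb uR _ bR sb (leqnn _).
  by move=> z; rewrite inE => /eqP->.
by rewrite -(canon_eq lb bc); apply: map_f.
Qed.

Lemma basis_ovoids_complete (b : seq pt) :
  is_ovoid b -> {subset basis <= b} -> b \in basis_ovoids.
Proof.
move=> /is_ovoidP[bc sb cb ub br] bb.
have [|||l lin lb] := cap_search_complete (fuel := 40) (k := 6) (ch := basis)
  (cands := [seq z <- reps | (z \notin basis) && proj_cap (z :: basis)])
  ub cb _ bb _ sb _.
- by vm_compute.
- move=> z zb; rewrite mem_cat mem_filter br // andbT.
  case: (z \in basis) => //=; apply: proj_cap_sub cb => w.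
  by rewrite inE => /orP[/eqP->|/bb].
- rewrite size_filter; apply: leq_trans (count_size _ _) _.
  by rewrite size_reps.
by rewrite -(canon_eq lb bc); apply: map_f.
Qed.

(** * Symmetric caps and ovoids *)

Section Bridge.
Local Open Scope ring_scope.

Definition t2f (t : trit) : 'F_3 := match t with T0 => 0 | T1 => 1 | T2 => -1 end.

Definition f2t (x : 'F_3) : trit := nth T0 trits x.

Lemma t2fK : cancel t2f f2t. Proof. by case. Qed.

Lemma f2tK : cancel f2t t2f.
Proof. by move=> [[|[|[|n]]] h] //; apply: val_inj. Qed.

Lemma t2fD (a b : trit) : t2f (tadd a b) = t2f a + t2f b.
Proof. by case: a; case: b; apply: val_inj. Qed.

Lemma t2fN (a : trit) : t2f (topp a) = - t2f a.
Proof. by case: a; apply: val_inj. Qed.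

Lemma t2fM (a b : trit) : t2f (tmul a b) = t2f a * t2f b.
Proof. by case: a; case: b; apply: val_inj. Qed.

Definition pseq (x : pt) : seq trit := let: Pt a b c d := x in [:: a; b; c; d].

Definition dec (x : pt) : AG43 := \col_(i < 4) t2f (nth T0 (pseq x) i).

Definition enc (v : AG43) : pt :=
  let c k (h : (k < 4)%N) := f2t (v (Ordinal h) 0) in
  Pt (c 0%N isT) (c 1%N isT) (c 2%N isT) (c 3%N isT).

Lemma decK : cancel dec enc.
Proof. by case=> a b c d; rewrite /enc !mxE /= !t2fK. Qed.

Lemma encK : cancel enc dec.
Proof.
move=> v; apply/colP => i; rewrite mxE.
by case: i => [[|[|[|[|n]]]] h] //=; rewrite f2tK; congr (v _ _); apply: val_inj.
Qed.

Lemma decD (x y : pt) : dec (padd x y) = dec x + dec y.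
Proof.
apply/colP => i; rewrite !mxE.
by case: x y i => a b c d [a' b' c' d'] [[|[|[|[|n]]]] h]; rewrite //= t2fD.
Qed.

Lemma decN (x : pt) : dec (popp x) = - dec x.
Proof.
apply/colP => i; rewrite !mxE.
by case: x i => a b c d [[|[|[|[|n]]]] h]; rewrite //= t2fN.
Qed.

Lemma dec0 : dec pzero = 0.
Proof. by apply/colP => -[[|[|[|[|n]]]] h]; rewrite !mxE. Qed.

Lemma encD (v w : AG43) : enc (v + w) = padd (enc v) (enc w).
Proof. by apply: (can_inj decK); rewrite decD !encK. Qed.

Lemma encN (v : AG43) : enc (- v) = popp (enc v).
Proof. by apply: (can_inj decK); rewrite decN !encK. Qed.

Lemma enc0 : enc 0 = pzero.
Proof. by rewrite -dec0 decK. Qed.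

Lemma enc_eq0 (v : AG43) : (enc v == pzero) = (v == 0).
Proof. by rewrite -enc0 (can_eq encK). Qed.

Definition mseq (m : mat) : seq pt := let: (c1, c2, c3, c4) := m in [:: c1; c2; c3; c4].

Definition mx_of (m : mat) : 'M['F_3]_4 :=
  \matrix_(i, j) t2f (nth T0 (pseq (nth pzero (mseq m) j)) i).

Lemma dec_mapply (m : mat) (x : pt) : dec (mapply m x) = mx_of m *m dec x.
Proof.
case: m x => [[[[a1 b1 c1 d1] [a2 b2 c2 d2]] [a3 b3 c3 d3]] [a4 b4 c4 d4]] [a b c d].
apply/colP => i; rewrite !mxE !big_ord_recl big_ord0 !mxE.
by case: i => [[|[|[|[|n]]]] h] //=; rewrite !t2fD !t2fM; ring.
Qed.

Lemma dot_mul (u v : AG43) : t2f (dot (enc u) (enc v)) = (u^T *m v) 0 0.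
Proof.
rewrite !mxE !big_ord_recl big_ord0 !mxE /= !t2fD !t2fM !f2tK.
rewrite addr0 !addrA; do ?congr (_ + _); congr (u _ _ * v _ _); exact: val_inj.
Qed.

Lemma pnorm_cases (x : pt) : pnorm x = x \/ pnorm x = popp x.
Proof. by case: x => [] [] [] [] []; first [by left | by right]. Qed.

Lemma pnormN (x : pt) : pnorm (popp x) = pnorm x.
Proof. by case: x => [] [] [] [] []. Qed.

Lemma pnorm_reps (x : pt) : (pnorm x \in reps) = (x != pzero).
Proof. by rewrite mem_reps; case: x => [] [] [] [] []. Qed.

Lemma pnorm_id (x : pt) : x \in reps -> pnorm x = x.
Proof. by rewrite mem_reps => /andP[_ /eqP]. Qed.

Lemma poppK : involutive popp.
Proof. by case=> [] [] [] [] []. Qed.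

Lemma popp_reps (x : pt) : x \in reps -> popp x \notin reps.
Proof. by rewrite !mem_reps; case: x => [] [] [] [] []. Qed.

Lemma dec_pnorm (S : {set AG43}) (v : AG43) :
  {in S, forall w, - w \in S} -> (dec (pnorm (enc v)) \in S) = (v \in S).
Proof.
move=> sS; case: (pnorm_cases (enc v)) => ->; rewrite ?decN encK //.
by apply/idP/idP => /sS; rewrite ?opprK.
Qed.

(** [cone] and [rays] translate between sets of points of PG(3,3) and sets of vectors that avoid 0
    and are closed under negation. *)
Definition cone (l : seq pt) : {set AG43} := [set v | pnorm (enc v) \in l].

Definition rays (S : {set AG43}) : seq pt := [seq x <- reps | dec x \in S].

Lemma coneN (l : seq pt) : {in cone l, forall v, - v \in cone l}.
Proof. by move=> v; rewrite !inE encN pnormN. Qed.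

Lemma cone0 (l : seq pt) : {subset l <= reps} -> 0 \notin cone l.
Proof. by move=> lr; rewrite inE enc0; apply/negP => /lr; rewrite mem_reps. Qed.

Lemma mem_cone_dec (l : seq pt) (x : pt) : x \in reps -> (dec x \in cone l) = (x \in l).
Proof. by move=> xr; rewrite inE decK pnorm_id. Qed.

Lemma mem_rays (S : {set AG43}) (x : pt) : (x \in rays S) = (x \in reps) && (dec x \in S).
Proof. by rewrite mem_filter andbC. Qed.

Lemma rays_reps (S : {set AG43}) : {subset rays S <= reps}.
Proof. by move=> x; rewrite mem_rays => /andP[]. Qed.

Lemma rays_uniq (S : {set AG43}) : uniq (rays S).
Proof. exact/filter_uniq/uniq_reps. Qed.

Lemma rays_canon (S : {set AG43}) : rays S == canon (rays S).
Proof.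
by apply/eqP/eq_in_filter => x xr; rewrite mem_rays xr.
Qed.

Lemma rays_cone (l : seq pt) : l == canon l -> rays (cone l) = l.
Proof.
move=> /eqP lc; rewrite [RHS]lc; apply: eq_in_filter => x xr.
exact: mem_cone_dec.
Qed.

Lemma cone_rays (S : {set AG43}) :
  0 \notin S -> {in S, forall v, - v \in S} -> cone (rays S) = S.
Proof.
move=> S0 sS; apply/setP => v; rewrite inE mem_rays pnorm_reps dec_pnorm //.
case: (boolP (v \in S)) => [vS|]; rewrite ?andbF // andbT enc_eq0.
by apply: contraNneq S0 => <-.
Qed.

Lemma card_cone (l : seq pt) :
  uniq l -> {subset l <= reps} -> #|cone l| = (size l).*2.
Proof.
move=> ul lr; have -> : cone l = [set v in map dec (l ++ map popp l)].
  apply/setP => v; rewrite !inE -{2}(encK v) (mem_map (can_inj decK)) mem_cat.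
  case: (pnorm_cases (enc v)) => E.
    rewrite E; case: (boolP (enc v \in l)) => //= nvl; apply/esym/negP => /mapP[x xl vE].
    move: E; rewrite vE pnormN pnorm_id ?lr // => E.
    by have := popp_reps (lr _ xl); rewrite -E lr.
  rewrite E; have [vl|nvl] := boolP (popp (enc v) \in l).
    by apply/esym/orP; right; apply/mapP; exists (popp (enc v)); rewrite ?poppK.
  apply/esym/negP => /orP[vl|/mapP[x xl vE]]; last by rewrite vE poppK xl in nvl.
  by rewrite -E pnorm_id ?lr // vl in nvl.
rewrite cardsE; have /card_uniqP-> : uniq (map dec (l ++ map popp l)).
  rewrite (map_inj_uniq (can_inj decK)) cat_uniq ul.
  rewrite (map_inj_uniq (can_inj poppK)) ul andbT.
  by apply/hasPn => x /mapP[y yl ->]; apply/negP => /lr; apply/negP/popp_reps/lr.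
by rewrite size_map size_cat size_map addnn.
Qed.

Lemma is_capP (S : {set AG43}) :
  reflect {in S & &, forall x y z : AG43, x != y -> y != z -> x != z -> x + y + z != 0}
          (is_cap S).
Proof.
have sum3 (x y z : AG43) : x != y -> y != z -> x != z ->
    #|x |: [set y; z]| = 3%N /\ \sum_(v in x |: [set y; z]) v = x + y + z.
  move=> xy yz xz; have nx : x \notin [set y; z] by rewrite !inE negb_or xy.
  have ny : y \notin [set z] by rewrite inE.
  by rewrite cardsU1 nx cards2 yz !big_setU1 //= big_set1 addrA.
apply: (iffP forallP) => [cS x y z xS yS zS xy yz xz | cS L].
  have [c3 s3] := sum3 _ _ _ xy yz xz; apply/negP => /eqP s0.
  have /implyP := cS (x |: [set y; z]); rewrite /is_line c3 s3 s0 !eqxx => /(_ isT).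
  by rewrite !subUset !sub1set xS yS zS.
apply/implyP => /andP[/eqP c3 /eqP s0]; apply/negP => /subsetP LS.
have /card_gt0P[x xL] : (0 < #|L|)%N by rewrite c3.
have := cardsD1 x L; rewrite xL c3 => -[] /esym/eqP/cards2P[y [z [yz LE]]].
have LxE : L = x |: [set y; z] by rewrite -LE setD1K.
have : x \notin [set y; z] by rewrite -LE !inE eqxx.
rewrite !inE negb_or => /andP[xy xz].
have [_ s3] := sum3 _ _ _ xy yz xz.
have yL : y \in L by rewrite LxE !inE eqxx orbT.
have zL : z \in L by rewrite LxE !inE eqxx !orbT.
by have := cS x y z (LS _ xL) (LS _ yL) (LS _ zL) xy yz xz; rewrite -s3 -LxE s0 eqxx.
Qed.

Lemma is_cap_bound (S : {set AG43}) : is_cap S -> (#|S| <= 20)%N.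
Proof.
move=> /is_capP cS; rewrite cardE -(size_map enc); apply: cap_bound.
  by rewrite (map_inj_uniq (can_inj encK)) enum_uniq.
move=> _ _ _ /mapP[x + ->] /mapP[y + ->] /mapP[z + ->]; rewrite !mem_enum.
rewrite !(can_eq encK) -!encD enc_eq0; exact: cS.
Qed.

(** Transfers [cap_hyperplane] to column vectors, in order to show that a maximal cap spans the
    space. *)
Lemma is_cap_hyperplane (S : {set AG43}) (u : AG43) :
  is_cap S -> u != 0 -> {in S, forall v, (u^T *m v) 0 0 = 0} -> (#|S| <= 9)%N.
Proof.
move=> /is_capP cS u0 hS; rewrite cardE -(size_map enc).
apply: (@cap_hyperplane (pnorm (enc u)) T0).
- by rewrite pnorm_reps enc_eq0.
- by rewrite (map_inj_uniq (can_inj encK)) enum_uniq.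
- move=> _ _ _ /mapP[x + ->] /mapP[y + ->] /mapP[z + ->]; rewrite !mem_enum.
  rewrite !(can_eq encK) -!encD enc_eq0; exact: cS.
move=> _ /mapP[v + ->]; rewrite mem_enum => /hS h0; apply: (can_inj t2fK).
case: (pnorm_cases (enc u)) => ->; rewrite -?encN dot_mul ?h0 //.
by rewrite linearN mulNmx mxE h0 oppr0.
Qed.

(** A line [x, y, -(x + y)] in the cone gives three points of [l] on a projective line, unless
    [y = -x], and then the third point would be 0. *)
Lemma proj_cap_cone (l : seq pt) : proj_cap l -> {subset l <= reps} -> is_cap (cone l).
Proof.
move=> cl lr; apply/is_capP => x y z; rewrite !inE => xl yl zl xy _ _.
apply/negP => /eqP s0; move: zl.
have -> : z = - (x + y) by apply/eqP; rewrite -addr_eq0 addrC s0.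
rewrite encN pnormN encD => zl.
(* Normalising [p] and [q] may change their signs, so up to sign [p + q] becomes the sum or the
   difference of the representatives. *)
have E : forall p q : pt, (p != q) ==>
    [|| padd p q == pzero |
     [&& pnorm p != pnorm q &
         pnorm (padd p q) \in [:: pnorm (padd (pnorm p) (pnorm q));
                                  pnorm (psub (pnorm p) (pnorm q))]]].
  by apply: forall_pt2; vm_compute.
have /implyP := E (enc x) (enc y); rewrite (can_eq encK) xy => /(_ isT).
case/orP=> [/eqP p0|/andP[pq]].
  by move/lr: zl; rewrite p0 mem_reps.
have [h1 h2] := proj_capP cl xl yl pq.
by rewrite !inE => /orP[] /eqP zE; move: zl; rewrite zE; apply/negP.
Qed.

(** By symmetry of [S], a third point of a secant would yield an affine line inside [S]; [H] is used
    for [x, y] and for [x, -y]. *)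
Lemma proj_cap_rays (S : {set AG43}) :
  is_cap S -> {in S, forall v, - v \in S} -> proj_cap (rays S).
Proof.
move=> /is_capP cS sS.
have E : forall p q : pt, (p != q) ==> (q != popp (padd p q)) && (p != popp (padd p q)).
  by apply: forall_pt2; vm_compute.
have H p q : dec p \in S -> dec q \in S -> p != q -> pnorm (padd p q) \notin rays S.
  move=> pS qS pq; apply/negP; rewrite mem_rays => /andP[_].
  rewrite -(decK (padd p q)) dec_pnorm // => /sS; rewrite -decN => zS.
  have /implyP/(_ pq)/andP[h1 h2] := E p q.
  have := cS _ _ _ pS qS zS; rewrite !(can_eq decK) pq h1 h2 => /(_ isT isT isT).
  by rewrite decN decD subrr eqxx.
apply/allP => x; rewrite (mem_rays S x) => /andP[xr xS].
apply/allP => y; rewrite (mem_rays S y) => /andP[yr yS].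
case: eqP => //= /eqP xy; rewrite !H //; first by rewrite decN sS.
by apply: contraTneq xr => ->; apply: popp_reps.
Qed.

End Bridge.

(** * Maximal caps with anchor 0 as cones over ovoids *)

Section Partitions.
Local Open Scope ring_scope.

Lemma addv3 (v : AG43) : v + v + v = 0.
Proof.
by apply: (can_inj encK); rewrite !encD enc0; case: (enc v) => [] [] [] [] [].
Qed.

Lemma E0_ovoid : is_ovoid E0. Proof. by vm_compute. Qed.

Lemma ovoid_cap (b : seq pt) : is_ovoid b -> is_cap (cone b) /\ #|cone b| = 20%N.
Proof.
move=> /is_ovoidP[_ sb cb ub br]; split; first exact: proj_cap_cone.
by rewrite card_cone // sb.
Qed.

(** The bound 20 is attained by the cone over [E0]. *)
Lemma is_maxcapE (S : {set AG43}) : is_maxcap S = is_cap S && (#|S| == 20%N).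
Proof.
apply/andP/andP => -[cS mS]; split=> //.
  rewrite eqn_leq is_cap_bound //=.
  by have [cE <-] := ovoid_cap E0_ovoid; apply: (implyP (forallP mS _)).
by apply/forallP => T; apply/implyP => /is_cap_bound; rewrite (eqP mS).
Qed.

(** The third point of the line through [a] and [v] is [-(a + v)], the reflection of [v] in [a], so
    an anchor is a centre of symmetry outside [S]. Conversely, the 20 points fall into 10 reflection
    pairs. *)
Lemma is_anchorP (a : AG43) (S : {set AG43}) : #|S| = 20%N ->
  reflect (a \notin S /\ {in S, forall v : AG43, - (a + v) \in S}) (is_anchor a S).
Proof.
move=> cS; apply: (iffP andP) => -[aS] => [/existsP[Q /and3P[_ /forallP hQ /eqP cQ]]|rS].
  split=> // x; rewrite -cQ => /bigcupP[p pQ xp].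
  have /implyP/(_ pQ)/andP[/cards2P[u [w [uw pE]]] /andP[_ /eqP s0]] := hQ p.
  apply/bigcupP; exists p => //.
  have ap : a \notin p.
    by apply: contra aS => ap; rewrite -cQ; apply/bigcupP; exists p.
  move: s0; rewrite big_setU1 //= pE big_setU1 ?inE //= big_set1.
  move: xp; rewrite pE !inE => /orP[] /eqP-> /eqP.
    by rewrite addrA addr_eq0 => /eqP->; rewrite opprK eqxx orbT.
  by rewrite (addrC u) addrA addr_eq0 => /eqP->; rewrite opprK eqxx.
split=> //; pose r (v : AG43) : AG43 := - (a + v).
have rK : involutive r by move=> v; rewrite /r opprD opprK addrA addNr add0r.
(* At a fixed point, [a + v = -v = v + v], hence [a = v]. *)
have rN v : v \in S -> v != r v.
  move=> vS; apply: contraNneq aS => vE; suff -> : a = v by [].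
  have h1 : a + v = - v by rewrite [in RHS]vE /r opprK.
  have h2 : v + v = - v by apply/eqP; rewrite -addr_eq0 addv3.
  by apply: (addIr v); rewrite h1 h2.
pose Q : {set {set AG43}} := [set [set v; r v] | v in S].
have pairE (v x : AG43) : x \in [set v; r v] -> [set v; r v] = [set x; r x].
  by rewrite !inE => /orP[] /eqP-> //; rewrite rK setUC.
have cov : cover Q = S.
  apply/setP => x; apply/bigcupP/idP => [[_ /imsetP[v vS ->]]|xS].
    by rewrite !inE => /orP[] /eqP->; rewrite ?rS.
  by exists [set x; r x]; [exact: imset_f | rewrite !inE eqxx].
have c2 : {in Q, forall A : {set AG43}, #|A| = 2%N}.
  by move=> _ /imsetP[v vS ->]; rewrite cards2 rN.
have pQ : partition Q S.
  rewrite /partition cov eqxx /=; apply/andP; split.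
    apply/trivIsetP => _ _ /imsetP[u uS ->] /imsetP[v vS ->]; apply: contraR.
    by move=> /pred0Pn[x /andP[/= /pairE-> /pairE->]].
  by apply/negP => /c2; rewrite cards0.
apply/existsP; exists Q; apply/and3P; split; last by rewrite cov.
  have := card_uniform_partition c2 pQ; rewrite cS => /eqP.
  by rewrite -[20%N]/(10 * 2)%N eqn_pmul2r // eq_sym.
apply/forallP => p; apply/implyP => pQ'; rewrite c2 //=.
have /imsetP[v vS pE] := pQ'.
have ap : a \notin p.
  rewrite pE !inE negb_or; apply/andP.
  by split; apply: contraNneq aS => ->; rewrite // rS.
rewrite /is_line cardsU1 ap c2 //= big_setU1 //= pE big_setU1 ?inE ?rN //=.
by rewrite big_set1 addrA subrr.
Qed.

Lemma ovoid_maxcap (b : seq pt) :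
  is_ovoid b -> is_maxcap (cone b) && is_anchor 0 (cone b).
Proof.
move=> ob; have [cb sb] := ovoid_cap ob; have [_ _ _ _ br] := is_ovoidP ob.
rewrite is_maxcapE cb sb /=; apply/is_anchorP => //.
by split=> [|v /coneN]; rewrite ?add0r ?cone0.
Qed.

(** With anchor 0 the cap is closed under negation, and its 20 points form 10 opposite pairs. *)
Lemma rays_ovoid (S : {set AG43}) :
  is_maxcap S -> is_anchor 0 S -> is_ovoid (rays S) /\ cone (rays S) = S.
Proof.
rewrite is_maxcapE => /andP[cS /eqP sS] /(is_anchorP _ sS)[S0 rS].
have nS : {in S, forall v, - v \in S} by move=> v /rS; rewrite add0r.
have fS := cone_rays S0 nS; split=> //.
rewrite /is_ovoid rays_canon proj_cap_rays // andbT.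
have := card_cone (rays_uniq S) (@rays_reps S); rewrite fS sS.
by case: (size _) => [|[|[|[|[|[|[|[|[|[|[|n]]]]]]]]]]].
Qed.

(* Two distinct point reflections of S compose to a nontrivial translation,
   whose orbits are lines. *)
Lemma anchor_unique (a b : AG43) (S : {set AG43}) :
  is_maxcap S -> is_anchor a S -> is_anchor b S -> a = b.
Proof.
rewrite is_maxcapE => /andP[/is_capP cS /eqP sS].
move=> /(is_anchorP _ sS)[_ rA] /(is_anchorP _ sS)[_ rB].
apply/eqP; rewrite -subr_eq0; apply/negPn/negP => d0; set d := a - b in d0.
have tS v : v \in S -> v + d \in S.
  by move=> /rA/rB; rewrite opprD opprK addrA (addrC (- b)) addrC.
have /card_gt0P[x xS] : (0 < #|S|)%N by rewrite sS.
have := cS _ _ _ xS (tS _ xS) (tS _ (tS _ xS)).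
have E v : (v == v + d) = false.
  by rewrite -[X in X == _]addr0 (inj_eq (addrI v)) eq_sym (negPf d0).
rewrite !E -addrA -[X in X == _]addr0 (inj_eq (addrI x)).
have -> : (0 == d + d) = false.
  rewrite eq_sym; apply/negP => /eqP dd.
  by have := addv3 d; rewrite dd add0r => /eqP; apply/negP.
move=> /(_ isT isT isT) /negP[]; rewrite -addrA.
have -> : x + (x + d + (x + (d + d))) = (x + x + x) + (d + d + d).
  by apply/colP => i; rewrite !mxE; ring.
by rewrite !addv3 addr0.
Qed.

End Partitions.

(** * Invariance under Aff(4,3) *)

Section Affine.
Local Open Scope ring_scope.

Implicit Types (s : {perm AG43}) (S X Y : {set AG43}) (P : {set {set AG43}}).

Lemma Aff43P s :
  reflect (exists A : 'M['F_3]_4, exists b : AG43,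
             A \in unitmx /\ forall v, s v = A *m v + b)
          (s \in Aff43).
Proof.
rewrite inE; apply: (iffP existsP) => [[A /existsP[b /andP[uA /forallP sE]]]|].
  by exists A, b; split=> // v; apply/eqP.
move=> [A [b [uA sE]]]; exists A; apply/existsP; exists b; rewrite uA.
by apply/forallP => v; rewrite sE.
Qed.

Lemma affine_perm (A : 'M['F_3]_4) (b : AG43) :
  A \in unitmx -> exists2 s, s \in Aff43 & forall v, s v = A *m v + b.
Proof.
move=> uA; have inj : injective (fun v : AG43 => A *m v + b).
  by move=> u v /addIr /(can_inj (mulKmx uA)).
exists (perm inj) => [|v]; last by rewrite permE.
by apply/Aff43P; exists A, b; split=> // v; rewrite permE.
Qed.

(** The translation part contributes [b + b + b = 0]. *)
Lemma aff_sum3 s x y z : s \in Aff43 -> x + y + z = 0 -> s x + s y + s z = 0.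
Proof.
move=> /Aff43P[A [b [_ sE]]] h.
have -> : s x + s y + s z = A *m (x + y + z) + (b + b + b).
  by rewrite !sE !mulmxDr; apply/colP => i; rewrite !mxE; ring.
by rewrite h addv3 mulmx0 addr0.
Qed.

Lemma affV s : s \in Aff43 -> s^-1%g \in Aff43.
Proof. by move=> sA; rewrite (groupV Aff43_group). Qed.

Lemma aff_cap s S : s \in Aff43 -> is_cap S -> is_cap (s @: S).
Proof.
move=> sA /is_capP cS; apply/is_capP.
move=> _ _ _ /imsetP[x xS ->] /imsetP[y yS ->] /imsetP[z zS ->].
rewrite !(inj_eq perm_inj) => xy yz xz.
apply: contraNneq (cS _ _ _ xS yS zS xy yz xz) => /(aff_sum3 (affV sA)).
by rewrite !permK => ->.
Qed.

Lemma aff_maxcap s S : s \in Aff43 -> is_maxcap S -> is_maxcap (s @: S).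
Proof.
move=> sA; rewrite !is_maxcapE => /andP[cS sS].
by rewrite aff_cap //= card_imset //; apply: perm_inj.
Qed.

Lemma maxcap_card S : is_maxcap S -> #|S| = 20%N.
Proof. by rewrite is_maxcapE => /andP[_ /eqP]. Qed.

Lemma aff_anchor s a S :
  s \in Aff43 -> is_maxcap S -> is_anchor a S -> is_anchor (s a) (s @: S).
Proof.
move=> sA mS /(is_anchorP _ (maxcap_card mS))[aS rS].
apply/is_anchorP; first exact/maxcap_card/aff_maxcap.
split; first by rewrite (mem_imset _ _ (@perm_inj _ s)).
move=> _ /imsetP[x xS ->]; apply/imsetP; exists (- (a + x)); first exact: rS.
by apply/eqP; rewrite eq_sym -addr_eq0 addrC aff_sum3 // subrr.
Qed.

Lemma actE s P : ('P^*^*)%act P s = [set s @: (X : {set AG43}) | X in P].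
Proof. by []. Qed.

Lemma mem_act s P X : (s @: X \in ('P^*^*)%act P s) = (X \in P).
Proof. exact/mem_imset/imset_inj/perm_inj. Qed.

Lemma aff_partition s a P :
  s \in Aff43 -> is_cap_partition a P -> is_cap_partition (s a) (('P^*^*)%act P s).
Proof.
move=> sA /and4P[pP aP /eqP c4 /forallP bP].
have inj := imset_inj (@perm_inj _ s).
have D1 : ('P^*^*)%act P s :\ [set s a] =
    [set s @: (X : {set AG43}) | X in P :\ [set a]].
  rewrite -(imset_set1 s a) actE; apply/setP => Y; apply/setD1P/imsetP => [[Ya]|[X]].
    move=> /imsetP[X XP YE]; exists X; rewrite // !inE XP andbT.
    by apply: contraNneq Ya => <-; rewrite YE.
  by rewrite 2!inE => /andP[Xa XP] ->; rewrite (inj_eq inj) imset_f.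
apply/and4P; split.
- have <- : s @: [set: AG43] = [set: AG43].
    apply/setP => v; rewrite inE.
    by apply/imsetP; exists (s^-1%g v); rewrite ?inE ?permKV.
  by rewrite actE imset_partition //; apply: perm_inj.
- by rewrite -(imset_set1 s a) mem_act.
- by rewrite D1 card_imset ?c4.
apply/forallP => Y; apply/implyP; rewrite D1 => /imsetP[X XP ->].
have /implyP/(_ XP)/andP[mX aX] := bP X.
by rewrite aff_maxcap //= aff_anchor.
Qed.

Lemma aff_cap_partitions s P :
  s \in Aff43 -> P \in cap_partitions -> ('P^*^*)%act P s \in cap_partitions.
Proof.
move=> sA; rewrite !inE => /existsP[a aP]; apply/existsP; exists (s a).
exact: aff_partition.
Qed.

Lemma permKimset s S : s^-1%g @: (s @: S) = S.
Proof.
rewrite -imset_comp -[RHS]imset_id; apply: eq_imset => x /=.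
by rewrite permK.
Qed.

(** Taking images under [s] is injective on partitions. Applied to [s^-1] as well, this makes the
    two counts equal. *)
Lemma aff_count_le s X Y : s \in Aff43 ->
  (#|[set P in cap_partitions | [set X; Y] \subset P]| <=
   #|[set P in cap_partitions | [set s @: X; s @: Y] \subset P]|)%N.
Proof.
move=> sA; rewrite -(card_imset _ (act_inj ('P^*^*)%act s)).
apply/subset_leq_card/subsetP => _ /imsetP[P + ->].
rewrite !inE -/cap_partitions => /andP[cP]; rewrite !subUset !sub1set !mem_act => ->.
rewrite andbT; have := @aff_cap_partitions s P sA; rewrite !inE; exact.
Qed.

Lemma aff_completable s k X Y :
  s \in Aff43 -> completable_pair k X Y -> completable_pair k (s @: X) (s @: Y).
Proof.
move=> sA /and5P[mX mY dXY /existsP[a /andP[aX aY]] /eqP kE].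
apply/and5P; split; rewrite ?aff_maxcap //.
- by rewrite imset_disjoint //; apply: perm_inj.
- by apply/existsP; exists (s a); rewrite !aff_anchor.
rewrite eqn_leq -{2}kE aff_count_le // andbT -kE.
by have := aff_count_le (s @: X) (s @: Y) (affV sA); rewrite !permKimset.
Qed.

Lemma aff_splits s k P :
  s \in Aff43 -> splits_into_completable_pairs k P ->
  splits_into_completable_pairs k (('P^*^*)%act P s).
Proof.
move=> sA [a [X [Y [Z [W [pP PE XY ZW]]]]]].
exists (s a), (s @: X), (s @: Y), (s @: Z), (s @: W).
split; [exact: aff_partition | | exact: aff_completable..].
by rewrite actE PE !imsetU !imset_set1.
Qed.

(** The kernel is closed under negation, so a nonzero kernel vector would show up among [reps]. *)
Lemma mx_of_unit (m : mat) : mat_inj m -> mx_of m \in unitmx.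
Proof.
move=> /allP mi; rewrite -unitmx_tr -row_free_unit; apply: inj_row_free => v v0.
have {}v0 : mx_of m *m v^T = 0 by apply: trmx_inj; rewrite trmx_mul trmxK v0 trmx0.
apply/eqP/negPn/negP => vn0.
have /mi : pnorm (enc v^T) \in reps.
  by rewrite pnorm_reps enc_eq0; apply: contraNneq vn0 => E; rewrite -[v]trmxK E trmx0.
rewrite -(can_eq decK) dec0 dec_mapply.
by case: (pnorm_cases (enc v^T)) => ->; rewrite ?decN encK ?mulmxN v0 ?oppr0 eqxx.
Qed.

(** Inclusion is enough, since both cones have 20 points. *)
Lemma maps_into_cone (m : mat) s (b c : seq pt) :
    (forall v, s v = mx_of m *m v) -> is_ovoid b -> is_ovoid c ->
    maps_into m b c -> s @: cone b = cone c.
Proof.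
move=> sE ob oc; rewrite /maps_into lazy_allE => /allP mbc.
have [_ cb] := ovoid_cap ob; have [_ cc] := ovoid_cap oc.
apply/eqP; rewrite eqEcard card_imset; last exact: perm_inj.
rewrite cb cc leqnn andbT; apply/subsetP => _ /imsetP[v + ->]; rewrite !inE => /mbc.
rewrite sE -{2}(encK v) -dec_mapply decK.
case: (pnorm_cases (enc v)) => -> //.
suff -> : mapply m (popp (enc v)) = popp (mapply m (enc v)) by rewrite pnormN.
by apply: (can_inj decK); rewrite decN !dec_mapply decN mulmxN.
Qed.

Lemma maps_parts_cone (m : mat) (bs bs' : seq (seq pt)) :
    all is_ovoid bs -> all is_ovoid bs' -> maps_parts m bs bs' ->
  exists2 s, s \in Aff43 &
    s 0 = 0 /\ {in bs, forall b, exists2 c, c \in bs' & s @: cone b = cone c}.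
Proof.
move=> /allP obs /allP obs'; rewrite /maps_parts lazy_allE; case: ifP => // /allP h mi.
have [s sA sE] := affine_perm 0 (mx_of_unit mi).
have {}sE v : s v = mx_of m *m v by rewrite sE addr0.
exists s => //; split=> [|b bin]; first by rewrite sE mulmx0.
have := h _ bin; rewrite lazy_hasE => /hasP[c cin mbc]; exists c => //.
by apply: maps_into_cone mbc => //; [apply: obs | apply: obs'].
Qed.

End Affine.

(** * Partitions *)

Section Classification.
Local Open Scope ring_scope.

Implicit Types (s : {perm AG43}) (S X Y : {set AG43}) (P : {set {set AG43}}).

(** Otherwise a nonzero linear form vanishes on [S], a column of [cokermx M], and [S] has at most 9
    points. *)
Lemma maxcap_basis S : is_maxcap S ->
  exists2 B : 'M['F_3]_4, B \in unitmx & forall i, col i B \in S.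
Proof.
move=> mS; pose M : 'M['F_3]_(#|S|, 4) := \matrix_(i < #|S|) (enum_val i)^T.
have fM : row_full M.
  rewrite -cokermx_eq0; apply/negPn/negP => K0.
  have [j Kj] : exists j, col j (cokermx M) != 0.
    apply/existsP; apply: contraR K0; rewrite negb_exists => /forallP h.
    apply/eqP/matrixP => i j; have /negPn/eqP/colP/(_ i) := h j.
    by rewrite !mxE.
  move: (mS); rewrite is_maxcapE => /andP[cS /eqP sS].
  suff le9 : (#|S| <= 9)%N by rewrite sS in le9.
  apply: (is_cap_hyperplane cS Kj) => v vS.
  have h : v^T *m col j (cokermx M) = 0.
    have <- : row (enum_rank_in vS v) M = v^T by rewrite rowK enum_rankK_in.
    by rewrite colE mulmxA -row_mul mulmx_coker row0 mul0mx.
  have -> : (col j (cokermx M))^T *m v = (v^T *m col j (cokermx M))^T.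
    by rewrite trmx_mul trmxK.
  by rewrite h !mxE.
exists (rowsub (fullrankfun fM) M)^T => [|i].
  by rewrite unitmx_tr fullrowsub_unit.
have -> : col i (rowsub (fullrankfun fM) M)^T = enum_val (fullrankfun fM i).
  by apply/colP => k; rewrite !mxE.
exact: enum_valP.
Qed.

Lemma maxcap_E0 a S : is_maxcap S -> is_anchor a S ->
  exists2 s, s \in Aff43 & s @: S = cone E0.
Proof.
move=> mS aS.
(* [t] moves the anchor to 0; [u] below moves a basis contained in the cap to the standard basis. *)
have [t tA tE] := affine_perm (- a) (unitmx1 'F_3 4).
have t0 : t a = 0 by rewrite tE mul1mx subrr.
have mS1 := aff_maxcap tA mS; have := aff_anchor tA mS aS; rewrite t0 => aS1.
have [B uB BS] := maxcap_basis mS1.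
have uB' : invmx B \in unitmx by rewrite unitmx_inv.
have [u uA uE] := affine_perm 0 uB'.
have u0 : u 0 = 0 by rewrite uE mulmx0 addr0.
have mS2 := aff_maxcap uA mS1; have := aff_anchor uA mS1 aS1; rewrite u0 => aS2.
set S2 := u @: (t @: S) in mS2 aS2.
have [oS2 S2E] := rays_ovoid mS2 aS2.
have bS2 : {subset basis <= rays S2}.
  have colS (i : 'I_4) : delta_mx i 0 \in S2.
    apply/imsetP; exists (col i B); first exact: BS.
    by rewrite uE addr0 colE mulKmx.
  move=> e eb; rewrite mem_rays; apply/andP; split.
    by move: e eb; apply/allP; vm_compute.
  have [i ->] : exists i : 'I_4, dec e = delta_mx i 0; last exact: colS.
  move: eb; rewrite !inE => /or4P[] /eqP->.
  - exists 0; apply/colP => -[[|[|[|[|n]]]] h] //; rewrite !mxE //=.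
  - exists 1; apply/colP => -[[|[|[|[|n]]]] h] //; rewrite !mxE //=.
  - exists 2%:R; apply/colP => -[[|[|[|[|n]]]] h] //; rewrite !mxE //=.
  - exists 3%:R; apply/colP => -[[|[|[|[|n]]]] h] //; rewrite !mxE //=.
have /allP/(_ _ (basis_ovoids_complete oS2 bS2)) := basis_ovoids_equiv.
rewrite oS2 lazy_hasE => /hasP[m _ mp].
have oE : all is_ovoid [:: E0] by rewrite all_seq1 E0_ovoid.
have oS : all is_ovoid [:: rays S2] by rewrite all_seq1 oS2.
have [w wA [_ wE]] := maps_parts_cone oE oS mp.
have [c + {}wE] := wE _ (mem_head _ _); rewrite inE => /eqP cE.
(* [w] carries the cone over [E0] to [S2], hence the inverse. *)
exists (t * u * w^-1)%g.
  by rewrite !(groupM (G := Aff43_group)) ?affV.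
rewrite -[RHS](permKimset w) wE cE S2E /S2 -!imset_comp; apply: eq_imset => v /=.
by rewrite !permM.
Qed.

Definition Part (bs : seq (seq pt)) : {set {set AG43}} :=
  [set X in [set 0] :: map cone bs].

Lemma mem_Part (bs : seq (seq pt)) b : b \in bs -> cone b \in Part bs.
Proof. by move=> bin; rewrite !inE map_f ?orbT. Qed.

Lemma card_AG43 : #|[set: AG43]| = 81%N.
Proof. by rewrite cardsT card_mx card_Fp. Qed.

Lemma ovoid_cone0 b : is_ovoid b -> cone b != [set 0].
Proof.
by move=> /ovoid_cap[_ cb]; apply: contra_eq_neq cb => ->; rewrite cards1.
Qed.

Lemma Part_D1 (bs : seq (seq pt)) :
  all is_ovoid bs -> Part bs :\ [set 0] = [set X in map cone bs].
Proof.
move=> /allP obs; apply/setP => X; rewrite !inE; case: eqP => // -> /=.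
by apply/esym/negP => /mapP[b /obs/ovoid_cone0/eqP + E]; apply.
Qed.

(** All 81 points are covered by [{0}] and at most four sets of 20 points. So there are four, and 1
    + 4 * 20 = 81 leaves no room for overlap. *)
Lemma Part_partition (bs : seq (seq pt)) :
  good_parts bs -> is_cap_partition 0 (Part bs).
Proof.
move=> /and3P[/eqP s4 aobs /allP cbs].
have D1 := Part_D1 aobs; have /allP obs := aobs.
have mbs X : X \in Part bs :\ [set 0] -> is_maxcap X && is_anchor 0 X.
  by rewrite D1 inE => /mapP[b /obs ob ->]; apply: ovoid_maxcap.
have P0 : [set 0] \in Part bs by rewrite !inE eqxx.
have cov : cover (Part bs) = [set: AG43].
  apply/setP => v; rewrite inE; apply/bigcupP.
  have [->|v0] := eqVneq v 0; first by exists [set 0]; rewrite ?set11.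
  have /cbs/hasP[b bin vb] : pnorm (enc v) \in reps by rewrite pnorm_reps enc_eq0.
  by exists (cone b); [apply: mem_Part | rewrite inE].
have sumE : (\sum_(X in Part bs) #|X| = 1 + #|Part bs :\ [set 0%R]| * 20)%N.
  rewrite (big_setD1 [set 0]) //= cards1 -sum_nat_const; congr addn.
  by apply: eq_bigr => X /mbs/andP[/maxcap_card].
have le4 : (#|Part bs :\ [set 0%R]| <= 4)%N.
  rewrite D1 cardsE; apply: leq_trans (card_size _) _.
  by rewrite size_map s4.
have := (leq_card_cover (Part bs)).1; rewrite cov card_AG43 sumE => ge4.
have c4 : #|Part bs :\ [set 0]| = 4%N by lia.
apply/and4P; split=> //; last 2 first.
- by rewrite c4.
- by apply/forallP => X; apply/implyP => /mbs.
apply/and3P; split; first by rewrite cov.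
  by rewrite /trivIset sumE c4 cov card_AG43.
apply/negP => h0; have : set0 \in Part bs :\ [set 0].
  by rewrite in_setD1 h0 andbT; apply/eqP => /setP/(_ 0); rewrite !inE eqxx.
by move=> /mbs/andP[/maxcap_card]; rewrite cards0.
Qed.

Lemma block_ovoid P X : is_cap_partition 0 P -> X \in P -> X != [set 0] ->
  is_ovoid (rays X) /\ cone (rays X) = X.
Proof.
move=> /and4P[_ _ _ /forallP h] XP X0.
have := h X; rewrite in_setD1 X0 XP /= => /andP[mX aX].
exact: rays_ovoid.
Qed.

Lemma mem_rays_block P X r : is_cap_partition 0 P -> X \in P -> r \in reps ->
  (r \in rays X) = (X == pblock P (dec r)).
Proof.
move=> /and4P[/and3P[/eqP cP tP _] _ _ _] XP rr; rewrite mem_rays rr /=.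
apply/idP/eqP => [rX|->]; first by rewrite (def_pblock tP XP rX).
by rewrite mem_pblock cP inE.
Qed.

Lemma pblock_reps P r : is_cap_partition 0 P -> r \in reps ->
  pblock P (dec r) \in P :\ [set 0].
Proof.
move=> /and4P[/and3P[/eqP cP tP _] _ _ _] rr.
rewrite in_setD1 pblock_mem ?cP ?inE // andbT.
apply: contraTneq rr => E; have : dec r \in pblock P (dec r) by rewrite mem_pblock cP inE.
by rewrite E in_set1 -enc_eq0 decK => /eqP->; rewrite mem_reps.
Qed.

Lemma head_rest (bs : seq (seq pt)) :
  rest bs != [::] -> head pzero (rest bs) \in rest bs.
Proof. by case: (rest bs) => // x l _; rewrite mem_head. Qed.

Lemma mem_rest (bs : seq (seq pt)) r :
  (r \in rest bs) = (r \in reps) && ~~ has (fun b => r \in b) bs.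
Proof. by rewrite mem_filter andbC. Qed.

(** The block [Z] through the first point outside [X] and [Y] provides [c]; the last block [W] then
    consists of the remaining points. *)
Lemma partition_completion P X Y :
    is_cap_partition 0 P -> X \in P :\ [set 0] -> Y \in P :\ [set 0] -> X != Y ->
  exists2 c, c \in completions (rays X) (rays Y) &
             P = Part (complete (rays X) (rays Y) c).
Proof.
move=> pP; rewrite !in_setD1 => /andP[X0 XP] /andP[Y0 YP] XY.
have [oX XE] := block_ovoid pP XP X0; have [oY YE] := block_ovoid pP YP Y0.
have memx := fun r => @mem_rays_block P X r pP XP.
have memy := fun r => @mem_rays_block P Y r pP YP.
move: (rays X) (rays Y) oX XE oY YE memx memy => x y oX XE oY YE memx memy.
have [_ sx _ _ _] := is_ovoidP oX; have [_ sy _ _ _] := is_ovoidP oY.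
(* [x] and [y] contain only 20 of the 40 projective points. *)
have R0 : rest [:: x; y] != [::].
  apply/eqP => R0; have : (size reps <= size (x ++ y))%N.
    apply: uniq_leq_size uniq_reps _ => r rr; rewrite mem_cat; apply/negPn/negP => nr.
    have : r \in rest [:: x; y] by rewrite mem_rest rr /= orbF nr.
    by rewrite R0.
  by rewrite size_cat sx sy size_reps.
set q := head pzero (rest [:: x; y]).
have qR : q \in rest [:: x; y] := head_rest R0.
have /andP[qr] : (q \in reps) && ~~ has (fun b => q \in b) [:: x; y] by rewrite -mem_rest.
rewrite /= orbF negb_or => /andP[qx qy].
pose Z := pblock P (dec q).
have : Z \in P :\ [set 0] by apply: pblock_reps.
rewrite in_setD1 => /andP[Z0 ZP].
have ZX : Z != X by apply: contraNneq qx => E; rewrite (memx _ qr) -E.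
have ZY : Z != Y by apply: contraNneq qy => E; rewrite (memy _ qr) -E.
have [oZ ZE] := block_ovoid pP ZP Z0.
have memz := fun r => @mem_rays_block P Z r pP ZP.
have zr := @rays_reps Z.
move: (rays Z) oZ ZE memz zr => c oZ ZE memz zr.
have qc : q \in c by rewrite (memz _ qr).
have [W WE] : exists W, P :\ [set 0] :\ X :\ Y :\ Z = [set W].
  apply/cards1P; have /and4P[_ _ /eqP c4 _] := pP.
  move: c4; rewrite (cardsD1 X) in_setD1 X0 XP (cardsD1 Y) !in_setD1 (eq_sym Y) XY Y0 YP.
  by rewrite (cardsD1 Z) !in_setD1 ZX ZY Z0 ZP /= => -[]; rewrite add0n => ->.
have blocks V : V \in P = [|| V == [set 0], V == X, V == Y, V == Z | V == W].
  have := set11 W; rewrite -WE !in_setD1 => /and5P[_ _ _ _ WP].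
  have [->|V0] /= := eqVneq V [set 0]; first by have /and4P[_ -> _ _] := pP.
  have [->//|VX] /= := eqVneq V X; have [->//|VY] /= := eqVneq V Y.
  have [->//|VZ] /= := eqVneq V Z.
  have := in_set1 V W; rewrite -WE !in_setD1 VX VY VZ V0 /= => ->.
  by [].
have := set11 W; rewrite -WE !in_setD1 => /and5P[WZ WY WX W0 WP].
have [oW WcE] := block_ovoid pP WP W0.
have wE : rays W = rest [:: x; y; c].
  apply: eq_in_filter => r rr.
  have -> : (dec r \in W) = (r \in rays W) by rewrite mem_rays rr.
  rewrite /= orbF (memx _ rr) (memy _ rr).
  rewrite (memz _ rr) (mem_rays_block pP WP rr).
  have := pblock_reps pP rr; rewrite in_setD1 blocks => /andP[/negPf->] /=.
  by case/or4P=> /eqP->; rewrite ?eqxx ?orbT //= ?(negPf WX) ?(negPf WY) ?(negPf WZ) //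
     ?(eq_sym X) ?(eq_sym Y) ?(eq_sym Z) ?(negPf WX) ?(negPf WY) ?(negPf WZ).
have gd : good_parts (complete x y c).
  apply/and3P; split=> //; first by rewrite /= oZ -wE oW oY oX.
  apply/allP => r rr; rewrite /= -wE.
  rewrite (memx _ rr) (memy _ rr).
  rewrite (memz _ rr) (mem_rays_block pP WP rr).
  have := pblock_reps pP rr; rewrite in_setD1 blocks => /andP[/negPf->] /=.
  by case/or4P=> /eqP->; rewrite eqxx ?orbT.
exists c.
  rewrite mem_filter gd /= -/q qc; apply: ovoids_complete => //.
    exact/filter_uniq/uniq_reps.
  move=> r rc; have rr := zr _ rc.
  rewrite mem_rest rr /= orbF (memx _ rr) (memy _ rr).
  move: rc; rewrite (memz _ rr) => /eqP <-.
  by rewrite !(eq_sym _ Z) negb_or ZX ZY.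
apply/setP => V; rewrite blocks !inE -wE ZE WcE YE XE.
by case: (V == X); case: (V == Y); case: (V == Z); case: (V == W); rewrite ?orbT.
Qed.

(** A maximal cap has only one anchor, and that of a cone over an ovoid is 0. *)
Lemma partition_anchor0 a P b :
  is_cap_partition a P -> is_ovoid b -> cone b \in P -> a = 0.
Proof.
move=> /and4P[_ _ _ /forallP h] ob bP.
have /andP[mb ab] := ovoid_maxcap ob.
have /implyP := h (cone b); rewrite in_setD1 bP andbT => /(_ _)/andP[].
  by apply: contra_eq_neq (maxcap_card mb) => ->; rewrite cards1.
by move=> _ /(anchor_unique mb); apply.
Qed.

(** [F] maps the completions onto the partitions containing the pair. It is injective because [c] is
    recovered as the block through the first uncovered point [q]. *)
Lemma completion_count x y :
    is_ovoid x -> is_ovoid y -> x != y -> uniq (completions x y) ->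
  #|[set P in cap_partitions | [set cone x; cone y] \subset P]| =
  size (completions x y).
Proof.
move=> ox oy xy uC.
have [xc _ _ _ _] := is_ovoidP ox; have [yc _ _ _ _] := is_ovoidP oy.
pose F c := Part (complete x y c).
have -> : [set P in cap_partitions | [set cone x; cone y] \subset P] =
    [set P in map F (completions x y)].
  apply/setP => P; rewrite [RHS]inE [LHS]inE subUset !sub1set.
  apply/and3P/mapP => [[+ xP yP]|[c]].
    rewrite inE => /existsP[a aP]; have a0 := partition_anchor0 aP ox xP.
    rewrite a0 in aP.
    have [||| c cC PE] := partition_completion (X := cone x) (Y := cone y) aP.
    - by rewrite in_setD1 xP ovoid_cone0.
    - by rewrite in_setD1 yP ovoid_cone0.
    - by apply: contraNneq xy => /(congr1 rays); rewrite !rays_cone // => ->.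
    by move: cC PE; rewrite !rays_cone // => cC PE; exists c.
  rewrite mem_filter => /andP[/andP[gd _] _] ->; split.
  - by rewrite inE; apply/existsP; exists 0; apply: Part_partition.
  - by apply: mem_Part; rewrite !inE eqxx !orbT.
  - by apply: mem_Part; rewrite !inE eqxx !orbT.
have ovC c : c \in completions x y ->
    is_ovoid c /\ head pzero (rest [:: x; y]) \in c.
  by rewrite mem_filter => /andP[/andP[/and3P[_ /andP[oc _] _] qc] _].
suff injF : {in completions x y &, injective F}.
  have /card_uniqP uF : uniq (map F (completions x y)) by rewrite (map_inj_in_uniq injF).
  by rewrite cardsE uF size_map.
move=> c c' /ovC[oc qc] /ovC[oc' qc'] FE.
set q := head _ _ in qc qc'.
have [cc _ _ _ cr] := is_ovoidP oc; have [cc' _ _ _ _] := is_ovoidP oc'.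
have qr := cr _ qc.
have qR : q \in rest [:: x; y].
  apply: head_rest; apply/eqP => R0; move: qr; rewrite /q R0 mem_reps.
  by [].
move: q qc qc' qr qR => q qc qc' qr qR.
have : cone c \in F c' by rewrite -FE; apply: mem_Part; rewrite inE eqxx.
move: qR; rewrite mem_rest qr /= orbF negb_or => /andP[qx qy].
have dq : dec q \in cone c by rewrite (mem_cone_dec _ qr).
(* The blocks of [F c'] in order: [c'], the rest, [y], [x]; all but the first miss [q]. *)
rewrite !inE (negPf (ovoid_cone0 oc)) /= => /or4P[] /eqP E.
- by rewrite -(rays_cone cc) E rays_cone.
- move: dq; rewrite E (mem_cone_dec _ qr) mem_rest => /andP[_ /hasPn/(_ c')].
  by rewrite !inE eqxx !orbT qc' => /(_ isT).
- by move: dq; rewrite E (mem_cone_dec _ qr) (negPf qy).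
by move: dq; rewrite E (mem_cone_dec _ qr) (negPf qx).
Qed.

End Classification.

(** * The two affine classes *)

Section TwoClasses.
Local Open Scope ring_scope.

Implicit Types (s : {perm AG43}) (S X Y : {set AG43}) (P : {set {set AG43}}).

Lemma card_cap_partition a P : is_cap_partition a P -> #|P| = 5%N.
Proof. by move=> /and4P[_ aP /eqP c4 _]; rewrite (cardsD1 [set a]) aP c4. Qed.

Lemma good_parts_ovoids (bs : seq (seq pt)) : good_parts bs -> all is_ovoid bs.
Proof. by case/and3P. Qed.

Lemma good_parts_cap_partitions (bs : seq (seq pt)) :
  good_parts bs -> Part bs \in cap_partitions.
Proof. by move=> /Part_partition pP; rewrite inE; apply/existsP; exists 0. Qed.

(** Both partitions have five blocks, so it suffices that each block goes to a block. *)
Lemma maps_parts_Part (m : mat) (bs bs' : seq (seq pt)) :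
    good_parts bs -> good_parts bs' -> maps_parts m bs bs' ->
  exists2 s, s \in Aff43 & ('P^*^*)%act (Part bs) s = Part bs'.
Proof.
move=> gbs gbs'.
move=> /(maps_parts_cone (good_parts_ovoids gbs) (good_parts_ovoids gbs')).
move=> [s sA [s0 sE]]; exists s => //; apply/eqP; rewrite eqEcard.
rewrite (card_cap_partition (aff_partition sA (Part_partition gbs))).
rewrite (card_cap_partition (Part_partition gbs')) leqnn andbT.
apply/subsetP => Z; rewrite actE => /imsetP[X + ->].
rewrite inE in_cons => /orP[/eqP->|/mapP[b /sE[c cin bc] ->]].
  by rewrite imset_set1 s0 !inE eqxx.
by rewrite bc; apply: mem_Part.
Qed.

Lemma cap_partition_E0 P : P \in cap_partitions ->
  exists2 s, s \in Aff43 & exists y c,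
    [/\ y \in ovoids (rest [:: E0]), c \in completions E0 y &
        ('P^*^*)%act P s = Part (complete E0 y c)].
Proof.
rewrite inE => /existsP[a aP].
have [X XP] : exists X, X \in P :\ [set a].
  by have /and4P[_ _ /eqP c4 _] := aP; apply/card_gt0P; rewrite c4.
have /andP[mX aX] : is_maxcap X && is_anchor a X.
  by have /and4P[_ _ _ /forallP/(_ X)/implyP] := aP; apply.
have [s sA sX] := maxcap_E0 mX aX; exists s => //.
have pP := aff_partition sA aP.
have E0P : cone E0 \in ('P^*^*)%act P s.
  by rewrite -sX mem_act; move: XP; rewrite in_setD1 => /andP[].
have s0 : s a = 0 := partition_anchor0 pP E0_ovoid E0P.
rewrite s0 in pP; move: (('P^*^*)%act P s) pP E0P => Q pQ E0Q.
have ER : forall r, r \in rest [:: E0] = (r \in reps) && (r \notin E0).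
  by move=> r; rewrite mem_rest has_seq1.
have := head_rest_E0; rewrite (ER (head _ _)) => /andP[qr qE].
have YQ := pblock_reps pQ qr.
have [E0c _ _ _ _] := is_ovoidP E0_ovoid.
set Y := pblock _ _ in YQ.
have E0Q0 : cone E0 \in Q :\ [set 0] by rewrite in_setD1 E0Q ovoid_cone0 ?E0_ovoid.
have YE : cone E0 != Y.
  by rewrite -(mem_rays_block pQ E0Q qr) rays_cone.
have [c] := partition_completion pQ E0Q0 YQ YE.
rewrite (rays_cone E0c) => cC QE; exists (rays Y), c; split; [|exact: cC|exact: QE].
move: YQ; rewrite in_setD1 => /andP[Y0 YQ].
have [oY _] := block_ovoid pQ YQ Y0.
apply: ovoids_complete oY _ _ _.
- exact/filter_uniq/uniq_reps.
- move=> r rY; have rr := rays_reps rY; rewrite ER rr /=.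
  rewrite -(rays_cone E0c) (mem_rays_block pQ E0Q rr).
  by move: rY; rewrite (mem_rays_block pQ YQ rr) => /eqP<-.
by rewrite (mem_rays_block pQ YQ qr).
Qed.

Lemma cap_partition_normal P : P \in cap_partitions ->
  exists2 s, s \in Aff43 &
    ('P^*^*)%act P s = Part part1 \/ ('P^*^*)%act P s = Part part2.
Proof.
move=> /cap_partition_E0[s sA [y [c [yin cin sP]]]].
have gd : good_parts (complete E0 y c).
  by move: cin; rewrite mem_filter => /andP[/andP[]].
have /allP/(_ _ yin)/allP/(_ _ cin) := E0_partitions_equiv.
cbv zeta; rewrite lazy_hasE => /hasP[m _]; case: ifP => [m1 _|_ m2].
  have [t tA tE] := maps_parts_Part gd part1_good m1.
  exists (s * t)%g; first by rewrite (groupM (G := Aff43_group)).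
  by left; rewrite actM sP.
have [t tA tE] := maps_parts_Part gd part2_good m2.
exists (s * t)%g; first by rewrite (groupM (G := Aff43_group)).
by right; rewrite actM sP.
Qed.

Lemma block_mem (bs : seq (seq pt)) i : good_parts bs -> (i < 4)%N -> block bs i \in bs.
Proof. by move=> /and3P[/eqP s4 _ _] i4; rewrite mem_nth ?s4. Qed.

Lemma cone_block_neq (bs : seq (seq pt)) i j :
    good_parts bs -> (i < 4)%N -> (j < 4)%N -> i != j ->
  cone (block bs i) != cone (block bs j).
Proof.
move=> gd i4 j4 ij; have /and3P[/eqP s4 obs _] := gd.
have /and4P[_ _ /eqP c4 _] := Part_partition gd.
have /card_uniqP um : #|map cone bs| = size (map cone bs).
  by rewrite size_map s4; move: c4; rewrite (Part_D1 obs) cardsE.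
rewrite /block -!(nth_map _ set0) ?s4 //.
by rewrite nth_uniq // size_map s4.
Qed.

(** Stated as an equation, so that it also refutes completability for other values of [k']. *)
Lemma completable_block (bs : seq (seq pt)) (k k' i j : nat) :
    good_parts bs -> (i < 4)%N -> (j < 4)%N -> i != j -> has_completions k bs i j ->
  completable_pair k' (cone (block bs i)) (cone (block bs j)) = (k == k').
Proof.
move=> gd i4 j4 ij /andP[/eqP kE uC].
have /allP obs := good_parts_ovoids gd.
have oi := obs _ (block_mem gd i4); have oj := obs _ (block_mem gd j4).
have nij := cone_block_neq gd i4 j4 ij.
have /and4P[/and3P[_ tP _] _ _ _] := Part_partition gd.
have /andP[mi ai] := ovoid_maxcap oi; have /andP[mj aj] := ovoid_maxcap oj.
have dij : [disjoint cone (block bs i) & cone (block bs j)].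
  by move/trivIsetP: tP; apply=> //; apply: mem_Part; apply: block_mem.
rewrite /completable_pair mi mj dij completion_count //; last first.
  by apply: contraNneq nij => ->.
rewrite kE.
have -> : [exists a, is_anchor a (cone (block bs i)) &&
                     is_anchor a (cone (block bs j))].
  by apply/existsP; exists 0; rewrite ai.
by [].
Qed.

Lemma PartE (bs : seq (seq pt)) : good_parts bs ->
  Part bs = [set [set 0]; cone (block bs 0); cone (block bs 1); cone (block bs 2);
                 cone (block bs 3)].
Proof.
move=> /and3P[/eqP s4 _ _].
case: bs s4 => [|b0 [|b1 [|b2 [|b3 [|? ?]]]]] // _.
by apply/setP => X; rewrite !inE /block /= !orbA.
Qed.

Lemma splits_Part (bs : seq (seq pt)) (k : nat) :
    good_parts bs -> has_completions k bs 0 1 -> has_completions k bs 2 3 ->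
  splits_into_completable_pairs k (Part bs).
Proof.
move=> gd h01 h23.
exists 0, (cone (block bs 0)), (cone (block bs 1)), (cone (block bs 2)),
  (cone (block bs 3)).
split; [exact: Part_partition | exact: PartE | |].
  by rewrite (completable_block _ gd _ _ _ h01).
by rewrite (completable_block _ gd _ _ _ h23).
Qed.

Lemma completable_sym (k : nat) X Y : completable_pair k X Y -> completable_pair k Y X.
Proof.
move=> /and5P[mX mY dXY /existsP[a /andP[aX aY]] kE].
apply/and5P; split=> //; first by rewrite disjoint_sym.
  by apply/existsP; exists a; rewrite aX aY.
by rewrite setUC.
Qed.

(** In any splitting, block 0 is paired with one of the three other caps, and [k] is the count of
    that pair. *)
Lemma Part_splits (bs : seq (seq pt)) (k k1 k2 k3 : nat) :
    good_parts bs -> has_completions k1 bs 0 1 -> has_completions k2 bs 0 2 ->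
    has_completions k3 bs 0 3 ->
  splits_into_completable_pairs k (Part bs) -> k \in [:: k1; k2; k3].
Proof.
move=> gd h1 h2 h3 [a [X [Y [Z [W [_ PE XY ZW]]]]]].
have /allP obs := good_parts_ovoids gd.
have o0 := obs _ (block_mem gd (isT : 0 < 4)%N).
have [V VP cV] : exists2 V, V \in Part bs & completable_pair k (cone (block bs 0)) V.
  have : cone (block bs 0) \in Part bs by apply/mem_Part/block_mem.
  have [_ c20] := ovoid_cap o0.
  rewrite PE !inE => /orP[/orP[/orP[/orP[]|]|]|] /eqP E; rewrite E in c20 *.
  - by rewrite cards1 in c20.
  - by exists Y; rewrite // !inE eqxx ?orbT.
  - by exists X; [rewrite !inE eqxx ?orbT | apply: completable_sym].
  - by exists W; rewrite // !inE eqxx ?orbT.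
  - by exists Z; [rewrite !inE eqxx ?orbT | apply: completable_sym].
have /and5P[_ mV dV _ _] := cV; have cV20 := maxcap_card mV.
move: VP; rewrite (PartE gd) !inE => /orP[/orP[/orP[/orP[]|]|]|] /eqP E;
  rewrite E in cV dV cV20.
- by rewrite cards1 in cV20.
- by move: dV; rewrite -setI_eq0 setIid => /eqP V0; rewrite V0 cards0 in cV20.
- by rewrite (completable_block _ gd _ _ _ h1) // in cV; rewrite (eqP cV) eqxx.
- by rewrite (completable_block _ gd _ _ _ h2) // in cV; rewrite (eqP cV) eqxx orbT.
by rewrite (completable_block _ gd _ _ _ h3) // in cV; rewrite (eqP cV) eqxx !orbT.
Qed.

End TwoClasses.

Lemma part1_splits : splits_into_completable_pairs 1 (Part part1).
Proof.
have /and4P[h1 h2 _ _] := part1_completions.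
exact: splits_Part part1_good h1 h2.
Qed.

Lemma part2_splits : splits_into_completable_pairs 2 (Part part2).
Proof.
have /and4P[h1 h2 _ _] := part2_completions.
exact: splits_Part part2_good h1 h2.
Qed.

Lemma part1_nsplits : ~ splits_into_completable_pairs 2 (Part part1).
Proof.
have /and4P[h1 _ h2 h3] := part1_completions.
by move=> /(Part_splits part1_good h1 h2 h3).
Qed.

Lemma part2_nsplits : ~ splits_into_completable_pairs 1 (Part part2).
Proof.
have /and4P[h1 _ h2 h3] := part2_completions.
by move=> /(Part_splits part2_good h1 h2 h3).
Qed.

Lemma Aff43_class_sym (P Q : {set {set AG43}}) :
  P \in Aff43_class Q -> Q \in Aff43_class P.
Proof. by rewrite /Aff43_class (orbit_sym _ Aff43_group). Qed.

Lemma Aff43_class_splits (k : nat) (P Q : {set {set AG43}}) :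
  P \in Aff43_class Q -> splits_into_completable_pairs k Q ->
  splits_into_completable_pairs k P.
Proof. by move=> /orbitP[s sA <-]; apply: aff_splits. Qed.

Lemma Aff43_class_partitions (P Q : {set {set AG43}}) :
  P \in Aff43_class Q -> Q \in cap_partitions -> P \in cap_partitions.
Proof. by move=> /orbitP[s sA <-]; apply: aff_cap_partitions. Qed.

Lemma cap_partitions_cover (P : {set {set AG43}}) : P \in cap_partitions ->
  P \in Aff43_class (Part part1) \/ P \in Aff43_class (Part part2).
Proof.
move=> /cap_partition_normal[s sA [] sP]; [left | right];
by apply: Aff43_class_sym; rewrite -sP; apply: mem_orbit.
Qed.

Lemma Aff43_class_eq (P Q : {set {set AG43}}) :
  P \in Aff43_class Q -> Aff43_class P = Aff43_class Q.
Proof. by move=> PQ; apply/(orbit_eqP (G := Aff43_group)). Qed.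

Theorem theorem3p10 :
  #|cap_partition_classes| = 2 /\
  (forall P : {set {set AG43}}, P \in cap_partitions ->
     splits_into_completable_pairs 1 P \/ splits_into_completable_pairs 2 P) /\
  (exists E1 E2 : {set {set {set AG43}}},
     cap_partition_classes = [set E1; E2] /\
     (forall P : {set {set AG43}},
        P \in E1 <->
        P \in cap_partitions /\ splits_into_completable_pairs 1 P) /\
     (forall P : {set {set AG43}},
        P \in E2 <->
        P \in cap_partitions /\ splits_into_completable_pairs 2 P)).
Proof.
have c1 := good_parts_cap_partitions part1_good.
have c2 := good_parts_cap_partitions part2_good.
set E1 := Aff43_class (Part part1); set E2 := Aff43_class (Part part2).
have E1P (P : {set {set AG43}}) :
    P \in E1 <-> P \in cap_partitions /\ splits_into_completable_pairs 1 P.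
  split=> [PE|[cP sP]].
    split; first exact: Aff43_class_partitions PE c1.
    exact: Aff43_class_splits PE part1_splits.
  have [//|PE] := cap_partitions_cover cP.
  by case: part2_nsplits; apply: Aff43_class_splits sP; apply: Aff43_class_sym.
have E2P (P : {set {set AG43}}) :
    P \in E2 <-> P \in cap_partitions /\ splits_into_completable_pairs 2 P.
  split=> [PE|[cP sP]].
    split; first exact: Aff43_class_partitions PE c2.
    exact: Aff43_class_splits PE part2_splits.
  have [PE|//] := cap_partitions_cover cP.
  by case: part1_nsplits; apply: Aff43_class_splits sP; apply: Aff43_class_sym.
have clE : cap_partition_classes = [set E1; E2].
  apply/setP => E; rewrite in_set2; apply/imsetP/orP => [[P cP ->]|].
    by have [/Aff43_class_eq->|/Aff43_class_eq->] := cap_partitions_cover cP;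
      rewrite eqxx; [left | right].
  by case=> /eqP->; [exists (Part part1) | exists (Part part2)].
have E12 : E1 != E2.
  apply/eqP => E; have : Part part1 \in E1 by apply: orbit_refl.
  by rewrite E => /E2P[_ /part1_nsplits].
split; first by rewrite clE cards2 E12.
split=> [P /cap_partitions_cover[/E1P[_]|/E2P[_]]|]; [by left | by right |].
by exists E1, E2.
Qed.
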